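(* Let $G\neq 1$ be a finite nilpotent group and let $K:=\mathbb{Q}(G)$. Then the exponent of the finite abelian group $\mathbb{Z}_K/\mathbb{Z}[G]$ is a proper divisor of $|G|$ (i.e. it divides $|G|$ and is different from $|G|$). In particular, $|G|\,\mathbb{Z}_K\subseteq\mathbb{Z}[G]$.
   Context: For a finite group $G$, $\operatorname{Irr}(G)$ denotes the set of irreducible complex characters of $G$. $\mathbb{Q}(G):=\mathbb{Q}(\chi(g):\chi\in\operatorname{Irr}(G),\ g\in G)\subseteq\mathbb{C}$ is the number field generated by all character values of $G$. $\mathbb{Z}_K$ is the ring of integers of a number field $K$. $\mathbb{Z}[G]$ denotes the subring of $\mathbb{C}$ generated by all the character values $\chi(g)$ with $\chi\in\operatorname{Irr}(G)$, $g\in G$ (it is neither the group algebra nor the ring of generalized characters). It is an order contained in $\mathbb{Z}_{\mathbb{Q}(G)}$, so $\mathbb{Z}_{\mathbb{Q}(G)}/\mathbb{Z}[G]$ is a finite abelian group. *)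

(* Defs.v *)
From HB Require Import structures.
From mathcomp Require Import all_boot all_order all_algebra.
From mathcomp Require Import all_fingroup all_solvable all_field all_character.

Set Implicit Arguments.
Unset Strict Implicit.
Unset Printing Implicit Defensive.

Import Order.TTheory GRing.Theory Num.Theory.
Local Open Scope ring_scope.

(* Complex characters take their values in
   [algC], the algebraic numbers, so that all subrings and subfields below are
   subsets of [algC]; they are Prop-valued, no decidability being presupposed. *)

Inductive subring_gen (R : nzRingType) (X : R -> Prop) : R -> Prop :=
| subring_gen_in x : X x -> subring_gen X x
| subring_gen1 : subring_gen X 1
| subring_genB x y :
    subring_gen X x -> subring_gen X y -> subring_gen X (x - y)
| subring_genM x y :
    subring_gen X x -> subring_gen X y -> subring_gen X (x * y).

(* Inverses are total with 0^-1 = 0, so no side condition is needed. *)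
Inductive subfield_gen (F : fieldType) (X : F -> Prop) : F -> Prop :=
| subfield_gen_in x : X x -> subfield_gen X x
| subfield_gen1 : subfield_gen X 1
| subfield_genB x y :
    subfield_gen X x -> subfield_gen X y -> subfield_gen X (x - y)
| subfield_genM x y :
    subfield_gen X x -> subfield_gen X y -> subfield_gen X (x * y)
| subfield_genV x : subfield_gen X x -> subfield_gen X x^-1.

Definition char_value (gT : finGroupType) (G : {group gT}) (z : algC) : Prop :=
  exists (i : Iirr G) (g : gT), g \in G /\ z = 'chi_i g.

(* The field Q(G). *)
Definition char_field (gT : finGroupType) (G : {group gT}) : algC -> Prop :=
  subfield_gen (char_value G).

(* The ring Z[G]: neither the group algebra nor the ring of generalized
   characters. *)
Definition char_ring (gT : finGroupType) (G : {group gT}) : algC -> Prop :=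
  subring_gen (char_value G).

Definition ring_of_integers (K : algC -> Prop) (z : algC) : Prop :=
  K z /\ z \in Aint.

(* For additive subgroups B of A, multiplication by n kills the coset a + B in
   A / B exactly when a *+ n lies in B. *)
Definition kills_quotient (V : zmodType) (A B : V -> Prop) (n : nat) : Prop :=
  forall a, A a -> B (a *+ n).

(* e is the exponent of A / B: the least positive integer killing it. *)
Definition is_quotient_exponent (V : zmodType) (A B : V -> Prop) (e : nat) :
    Prop :=
  [/\ (0 < e)%N, kills_quotient A B e
    & forall n, (0 < n)%N -> kills_quotient A B n -> (e <= n)%N].

(* Main.v *)
(* Let K = Q(G), let n be a multiple of |G| and w a primitive n-th root of 1, so that K lies in
   Q(w). The proof, by induction on |G|, finds a prime p dividing |G| such that (|G|/p) Z_K is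
   contained in Z[G].

   The basic tool is a relative trace. If z is in Q(w) and is fixed by the automorphisms fixing
   the column of x in the character table, then the column orthogonality relations give
     |C_G(x)| z = \sum_chi c_chi chi(x),
   with c_chi the trace to Q of z chi(x^-1). If p is odd and P is a p-group, some x != 1 is such
   that all automorphisms fixing its column fix every character of P: the units of Z/p^N congruent
   to 1 mod p form a cyclic group, whose subgroups are totally ordered. A factor p is then gained
   from c_chi = chi(1) c_1 mod p and \sum_chi chi(1) chi(x) = 0. In general G = P x H with P the
   Sylow p-subgroup, and the traces relative to Q(H), with this x, reduce G to H.

   There remain the 2-groups A of order 2^N, for which odd multiples are harmless. Let m be least
   with Q(A) contained in Q(w_m), w_k being a primitive 2^k-th root of 1, and let s be an involution
   of Q(w_m) with s w_m = w_m^-1 or - w_m^-1, chosen so that chi + s chi is not always in Q(w_(m-1)).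
   As 2 is totally ramified in Q(w_k), a nonzero element of Z[w_k] divides 2^a M for some odd M as
   soon as 2^a bounds the absolute values of its conjugates. Applied to a sum of eigenvalues of
   order 2^k of an element of A, this shows that 2 xi(1) (e + s e) is in Z[A], up to an odd factor, for
   every e of order 2^k and a suitable irreducible xi; applied to the difference
   psi(h) - s psi(h), when it is nonzero, it recovers z from the traces y + s y. The sum of squares
   of the degrees of the Galois conjugates of xi and psi bounds the total loss by 2^(N-1). *)

Require Import Defs.
From HB Require Import structures.
From mathcomp Require Import all_boot all_order all_algebra.
From mathcomp Require Import all_fingroup all_solvable all_field all_character.
From mathcomp Require Import ring zify.
From Stdlib Require Import Classical.

Set Implicit Arguments.
Unset Strict Implicit.
Unset Printing Implicit Defensive.

Import Order.TTheory GRing.Theory Num.Theory.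
Local Open Scope ring_scope.

(** * Cyclotomic subfields of algC *)

Definition Qadj (w z : algC) := exists p : {poly rat}, z = (map_poly ratr p).[w].

Section QadjTheory.
Variable w : algC.

Lemma Qadj_gen : Qadj w w.
Proof. by exists 'X; rewrite map_polyX hornerX. Qed.

Lemma Qadj_rat q : Qadj w (ratr q).
Proof. by exists q%:P; rewrite map_polyC hornerC. Qed.

Lemma Qadj0 : Qadj w 0.
Proof. by rewrite -(rmorph0 (@ratr algC)); apply: Qadj_rat. Qed.

Lemma Qadj1 : Qadj w 1.
Proof. by rewrite -(rmorph1 (@ratr algC)); apply: Qadj_rat. Qed.

Lemma QadjD x y : Qadj w x -> Qadj w y -> Qadj w (x + y).
Proof. by case=> p -> [q ->]; exists (p + q); rewrite rmorphD hornerD. Qed.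

Lemma QadjN x : Qadj w x -> Qadj w (- x).
Proof. by case=> p ->; exists (- p); rewrite rmorphN hornerN. Qed.

Lemma QadjB x y : Qadj w x -> Qadj w y -> Qadj w (x - y).
Proof. by move=> Qx /QadjN; apply: QadjD. Qed.

Lemma QadjM x y : Qadj w x -> Qadj w y -> Qadj w (x * y).
Proof. by case=> p -> [q ->]; exists (p * q); rewrite rmorphM hornerM. Qed.

Lemma QadjX x k : Qadj w x -> Qadj w (x ^+ k).
Proof.
move=> Qx; elim: k => [|k IHk]; first by rewrite expr0; apply: Qadj1.
by rewrite exprS; apply: QadjM.
Qed.

Lemma Qadj_sum (I : Type) (r : seq I) (P : pred I) (F : I -> algC) :
  (forall i, P i -> Qadj w (F i)) -> Qadj w (\sum_(i <- r | P i) F i).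
Proof.
by move=> QF; elim/big_rec: _ => [|i x /QF]; [apply: Qadj0 | apply: QadjD].
Qed.

Lemma Qadj_horner (p : {poly rat}) x : Qadj w x -> Qadj w (map_poly ratr p).[x].
Proof.
move=> Qx; rewrite horner_coef; apply: Qadj_sum => i _.
by apply: QadjM; [rewrite coef_map; apply: Qadj_rat | apply: QadjX].
Qed.

End QadjTheory.

Lemma Qadj_trans v w z : Qadj w v -> Qadj v z -> Qadj w z.
Proof. by move=> Qv [p ->]; apply: Qadj_horner. Qed.

Lemma aut_Qadj (nu : {rmorphism algC -> algC}) w z : Qadj w z -> Qadj (nu w) (nu z).
Proof.
case=> p ->; exists p; rewrite -horner_map /= -map_poly_comp.
by congr _.[_]; apply: eq_map_poly => q /=; rewrite fmorph_rat.
Qed.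

Lemma Qadj_fix (nu : {rmorphism algC -> algC}) w z : Qadj w z -> nu w = w -> nu z = z.
Proof.
case=> p -> nuw; rewrite -horner_map /= nuw -map_poly_comp.
by congr _.[_]; apply: eq_map_poly => q /=; rewrite fmorph_rat.
Qed.

Lemma Qadj_eq_aut (nu mu : {rmorphism algC -> algC}) w z :
  Qadj w z -> nu w = mu w -> nu z = mu z.
Proof.
case=> p -> eq_w; rewrite -!horner_map /= eq_w -!map_poly_comp.
by congr _.[_]; apply: eq_map_poly => q /=; rewrite !fmorph_rat.
Qed.

Lemma Qadj_unity_root n w e : n.-primitive_root w -> e ^+ n = 1 -> Qadj w e.
Proof.
by move=> pr_w /(prim_rootP pr_w)[k ->]; apply/QadjX/Qadj_gen.
Qed.

Lemma aut_Qadj_prim (nu : {rmorphism algC -> algC}) n w z :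
  n.-primitive_root w -> Qadj w z -> Qadj w (nu z).
Proof.
move=> pr_w /(aut_Qadj nu); apply: Qadj_trans.
by apply: (Qadj_unity_root pr_w); rewrite -rmorphXn (prim_expr_order pr_w) rmorph1.
Qed.

(** Gives access to Galois theory: [L] is a copy of Q(w), obtained from a group of order n, and
    automorphisms extend from [L] to [algC] and restrict from [algC] to [L]. *)
Lemma cyclotomic_num_field n w : n.-primitive_root w ->
  {L : splittingFieldType rat & galois 1 {:L} & {io : {rmorphism L -> algC} &
   [/\ forall t : gal_of {:L}, exists nu : {rmorphism algC -> algC},
         {morph io : a / t a >-> nu a},
       forall nu : {rmorphism algC -> algC},
         exists2 t, t \in 'Gal({:L} / 1)%g & {morph io : a / t a >-> nu a}
     & forall z, Qadj w z <-> exists a, z = io a]}}.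
Proof.
move=> pr_w; have n_gt0 := prim_order_gt0 pr_w.
case: n n_gt0 => // n _ in pr_w *.
have [L galL [io lift [w0 [pr_w0 genL] _]]] := group_num_field_exists [set: 'I_n.+1]%G.
rewrite /= cardsT card_ord in pr_w0.
have pr_iw0: n.+1.-primitive_root (io w0) by rewrite fmorph_primitive_root.
exists L => //; exists io; split=> [t | nu | z].
- by case: (lift t) => nu Dnu; exists nu.
- have [nuQ DnuQ] := restrict_aut_to_normal_num_field io nu.
  have hom_nu: kHom 1 {:L} (linfun nuQ).
    rewrite k1HomE; apply/ahom_inP.
    by split=> [u v | ]; rewrite !lfunE ?rmorphM ?rmorph1.
  have [|t galt Dt] := kHom_to_gal _ (normalFieldf 1) hom_nu.
    by rewrite !subvf.
  by exists t => // a; rewrite -Dt ?memvf // lfunE DnuQ.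
have [k Dk] := prim_rootP pr_iw0 (prim_expr_order pr_w).
have Qw0: Qadj w (io w0) by exact: (Qadj_unity_root pr_w (prim_expr_order pr_iw0)).
split=> [[p ->] | [a ->]].
  exists (map_poly (in_alg L) p).[w0 ^+ k].
  rewrite -horner_map rmorphXn -Dk -map_poly_comp.
  by congr _.[_]; apply: eq_map_poly => q /=; rewrite rmorphZ_num rmorph1 mulr1.
have: a \in <<1; w0>>%VS by rewrite genL memvf.
case/Fadjoin_polyP=> p /polyOver1P[q ->] ->.
rewrite -horner_map -map_poly_comp.
rewrite (@eq_map_poly _ _ _ ratr) => [|b /=]; last by rewrite rmorphZ_num rmorph1 mulr1.
exact: Qadj_horner.
Qed.

(** The Galois correspondence for Q(v) inside Q(w), whose automorphisms all lift to [algC]. *)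
Lemma Qadj_galois n w v z : n.-primitive_root w -> Qadj w v -> Qadj w z ->
  (forall nu : {rmorphism algC -> algC}, nu v = v -> nu z = z) -> Qadj v z.
Proof.
move=> /cyclotomic_num_field[L galL [io [lift _ QE]]] /QE[v0 ->] /QE[z0 ->] fix_z.
have galLv: galois <<1; v0>> {:L} by apply: galoisS galL; rewrite sub1v subvf.
have: z0 \in <<1; v0>>%VS.
  rewrite -(galois_fixedField galLv); apply/fixedFieldP; rewrite ?memvf // => t Gt.
  have [nu Dnu] := lift t; apply: (fmorph_inj io); rewrite Dnu; apply: fix_z.
  by rewrite -Dnu (fixed_gal _ Gt) ?subvf ?memv_adjoin.
case/Fadjoin_polyP=> p /polyOver1P[q ->] ->; exists q.
rewrite -horner_map -map_poly_comp; congr _.[_].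
by apply: eq_map_poly => b /=; rewrite rmorphZ_num rmorph1 mulr1.
Qed.

Lemma Qadj_aut_int n w z : n.-primitive_root w -> Qadj w z -> z \in Aint ->
  (forall nu : {rmorphism algC -> algC}, nu z = z) -> z \in Num.int.
Proof.
move=> pr_w Qz Az fix_z; apply: Cint_rat_Aint Az.
have [|p ->] := Qadj_galois pr_w (Qadj1 w) Qz; first by move=> nu _.
by rewrite -(rmorph1 (@ratr algC)) horner_map Crat_rat.
Qed.

Section RelativeTransversal.

Variables (n : nat) (w : algC) (S X : seq algC).
Hypotheses (pr_w : n.-primitive_root w).
Hypotheses (QS : forall y, y \in S -> Qadj w y) (QX : forall y, y \in X -> Qadj w y).

(* The [t i] represent the cosets, in the group fixing S, of the subgroup fixing S and X. *)
Lemma relative_transversal :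
  exists (I : finType) (i0 : I) (t : I -> {rmorphism algC -> algC}),
  [/\ {in X, forall y, t i0 y = y} /\ (forall y, Qadj w y -> t i0 y = y),
      forall i, i != i0 -> exists2 y, y \in X & t i y != y
    & forall a, Qadj w a ->
        (forall nu : {rmorphism algC -> algC},
           {in S, forall y, nu y = y} -> {in X, forall y, nu y = y} -> nu a = a) ->
        forall nu : {rmorphism algC -> algC},
          {in S, forall y, nu y = y} -> nu (\sum_i t i a) = \sum_i t i a].
Proof.
have [L galL [io [lift restr QE]]] := cyclotomic_num_field pr_w.
have /fin_all_exists[sg Dsg] := lift.
have lifts (s : seq algC) : (forall y, y \in s -> Qadj w y) -> exists s0, s = map io s0.
  elim: s => [|y s IHs] Qs; first by exists [::].
  have /QE[y0 ->] := Qs y (mem_head _ _).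
  have [z sz|s0 ->] := IHs; first by apply: Qs; rewrite inE sz orbT.
  by exists (y0 :: s0).
have [[S0 DS] [X0 DX]] := (lifts S QS, lifts X QX).
have galP (s : seq L) (t : gal_of {:L}) :
    reflect {in s, forall y, t y = y} (t \in 'Gal({:L} / <<1 & s>>)%g).
  rewrite -sub1set galois_connection ?subvf //.
  apply: (iffP Fadjoin_seqP) => [[_ fix_s] y /fix_s | fix_s].
    by case/mem_fixedFieldP=> _; apply; rewrite inE.
  split=> [|y sy]; first exact: sub1v.
  by apply/fixedFieldP=> [|x /set1P->]; [apply: memvf | apply: fix_s].
pose H := 'Gal({:L} / <<1 & S0>>)%G; pose Hx := 'Gal({:L} / <<1 & S0 ++ X0>>)%G.
have sHxH: Hx \subset H.
  by apply: galS; apply: adjoin_seqSr => y; rewrite mem_cat => ->.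
pose I := {C in rcosets Hx H}.
have CHx : gval Hx \in rcosets Hx H.
  by apply/rcosetsP; exists 1%g; rewrite ?group1 ?mulg1.
pose i0 : I := exist _ (gval Hx) CHx.
have reprH (C : I) : repr (val C) \in H /\ val C = (Hx :* repr (val C))%g.
  case: C => C /= /rcosetsP[t Ht ->]; split; last by rewrite rcoset_repr.
  have := mem_repr_rcoset Hx t; case/rcosetP=> u Hu ->.
  by rewrite groupM // (subsetP sHxH).
have fix_io (s : seq L) (nu : {rmorphism algC -> algC}) (t : gal_of {:L}) :
  {morph io : a / t a >-> nu a} ->
  {in map io s, forall y, nu y = y} <-> {in s, forall y, t y = y}.
  move=> Dnu; split=> [fix_s y sy | fix_s _ /mapP[y sy ->]].
    by apply: (fmorph_inj io); rewrite Dnu fix_s ?map_f.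
  by rewrite -Dnu fix_s.
have SX0 y : y \in map io (S0 ++ X0) = (y \in S) || (y \in X).
  by rewrite map_cat mem_cat DS DX.
exists I, i0, (fun C : I => sg (repr (val C))); split.
- have sg1 y : Qadj w y -> sg (repr (val i0)) y = y.
    by case/QE=> a ->; rewrite /= repr_group -Dsg gal_id.
  by split=> // y /QX; apply: sg1.
- move=> C neqC; have [HrC DC] := reprH C.
  have: repr (val C) \notin Hx.
    apply: contra neqC => Hx_r; rewrite -val_eqE /= DC.
    by rewrite (rcoset_id Hx_r).
  case: (boolP (all (fun y => sg (repr (val C)) y == y) X)) => [/allP fixX | /allPn[y Xy]].
    case/negP; apply/galP => y0; rewrite mem_cat => /orP[S0y | X0y].
      by apply: (galP _ _ HrC).
    by apply: (fmorph_inj io); rewrite Dsg; apply/eqP/fixX; rewrite DX map_f.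
  by exists y.
move=> a /QE[{}a ->] fix_a nu fix_nu.
have [h _ Dh] := restr nu.
have Hh : h \in H.
  by apply/galP; apply: (iffLR (fix_io _ _ _ Dh)); rewrite -DS.
have fixHx t : t \in Hx -> t a = a.
  move=> /galP fix_t; have [mu Dmu] := lift t; apply: (fmorph_inj io).
  rewrite Dmu fix_a // => y => [Sy | Xy].
    by apply: (iffRL (fix_io _ _ _ Dmu) fix_t); rewrite SX0 Sy.
  by apply: (iffRL (fix_io _ _ _ Dmu) fix_t); rewrite SX0 Xy orbT.
(* As [Hx] fixes [a], all members of a coset take the same value at [a]; right multiplication by [h]
   permutes the cosets, which makes the sum invariant. *)
pose f (C : {set gal_of {:L}}) := (repr C) a.
have fE t : f (Hx :* t)%g = t a.
  by rewrite /f; case: repr_rcosetP => u Hu; rewrite galM ?memvf // fixHx.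
have sumE : \sum_(C : I) sg (repr (val C)) (io a) = io (\sum_(C in rcosets Hx H) f C).
  by rewrite rmorph_sum [RHS]big_sub /I; apply: eq_bigr => C _; rewrite -Dsg.
rewrite sumE -Dh; congr (io _); rewrite raddf_sum /=.
rewrite [RHS](reindex_inj (@rcoset_inj _ h)) /=; apply: eq_big => [C | _ /rcosetsP[t Ht ->]].
  apply/rcosetsP/rcosetsP=> [[t Ht ->] | [t Ht DC]].
    by exists (t * h)%g; rewrite ?groupM // rcosetM.
  by exists (t * h^-1)%g; rewrite ?groupM ?groupV // rcosetM -DC rcosetK.
by rewrite -rcosetM !fE galM ?memvf.
Qed.

End RelativeTransversal.

(** * The ring of character values and the relative trace *)

Section CharRing.
Variables (gT : finGroupType) (G : {group gT}).

Lemma char_ring_irr i g : char_ring G ('chi[G]_i g).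
Proof.
have [Gg | /cfun0->] := boolP (g \in G).
  by apply: subring_gen_in; exists i, g.
by rewrite -(subrr 1); apply: subring_genB; apply: subring_gen1.
Qed.

Lemma char_ring1 : char_ring G 1. Proof. exact: subring_gen1. Qed.

Lemma char_ring0 : char_ring G 0.
Proof. by rewrite -(subrr 1); apply: subring_genB; apply: subring_gen1. Qed.

Lemma char_ringB x y : char_ring G x -> char_ring G y -> char_ring G (x - y).
Proof. exact: subring_genB. Qed.

Lemma char_ringM x y : char_ring G x -> char_ring G y -> char_ring G (x * y).
Proof. exact: subring_genM. Qed.

Lemma char_ringN x : char_ring G x -> char_ring G (- x).
Proof. by rewrite -sub0r; apply: char_ringB char_ring0. Qed.

Lemma char_ringD x y : char_ring G x -> char_ring G y -> char_ring G (x + y).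
Proof. by move=> Rx /char_ringN; rewrite -{2}[y]opprK; apply: char_ringB. Qed.

Lemma char_ring_sum (I : Type) (r : seq I) (P : pred I) (F : I -> algC) :
  (forall i, P i -> char_ring G (F i)) -> char_ring G (\sum_(i <- r | P i) F i).
Proof.
move=> RF; elim/big_rec: _ => [|i x /RF]; first exact: char_ring0.
exact: char_ringD.
Qed.

Lemma char_ring_nat k : char_ring G k%:R.
Proof.
elim: k => [|k IHk]; first exact: char_ring0.
by rewrite mulrS; apply: char_ringD (char_ring1) IHk.
Qed.

Lemma char_ring_int (k : int) : char_ring G k%:~R.
Proof.
case: k => k; first exact: char_ring_nat.
by rewrite NegzE rmorphN; apply/char_ringN/char_ring_nat.
Qed.

Lemma char_ring_Cint z : z \in Num.int -> char_ring G z.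
Proof. by case/intrP=> k ->; apply: char_ring_int. Qed.

Lemma char_ring_char (phi : 'CF(G)) g : phi \is a character -> char_ring G (phi g).
Proof.
case/char_sum_irr=> r ->; rewrite sum_cfunE.
by apply: char_ring_sum => i _; apply: char_ring_irr.
Qed.

Lemma char_ring_aut (nu : {rmorphism algC -> algC}) z :
  char_ring G z -> char_ring G (nu z).
Proof.
elim=> [_ [i [g [_ ->]]] | | x y _ Rx _ Ry | x y _ Rx _ Ry].
- by have := char_ring_irr (aut_Iirr nu i) g; rewrite aut_IirrE cfunE.
- by rewrite rmorph1; apply: char_ring1.
- by rewrite rmorphB; apply: char_ringB.
by rewrite rmorphM; apply: char_ringM.
Qed.

(** The [e i] are the eigenvalues of [x]; a basis diagonalizing [x] diagonalizes its powers too, so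
    that one family serves all [k]. *)
Lemma char_roots (phi : 'CF(G)) x : phi \is a character -> x \in G ->
  exists (f : nat) (e : 'I_f -> algC),
    [/\ forall i, e i ^+ #[x]%g = 1, phi 1%g = f%:R
      & forall k, phi (x ^+ k)%g = \sum_i e i ^+ k].
Proof.
case/char_reprP=> rG -> Gx; have [e [[B uB Dx] [e1 _] _ _]] := repr_rsim_diag rG Gx.
exists (rdegree rG), (e 0); split=> [// | | k]; first by rewrite cfRepr1.
rewrite cfunE groupX // mulr1n.
have -> : rG (x ^+ k)%g = invmx B *m diag_mx (map_mx (fun a => a ^+ k) e) *m B.
  elim: k => [|k IHk].
    rewrite expg0 repr_mx1 (_ : map_mx _ _ = const_mx 1) ?diag_const_mx.
      by rewrite mulmx1 mulVmx.
    by apply/rowP=> i; rewrite !mxE expr0.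
  rewrite expgSr repr_mxM ?groupX // IHk Dx !mulmxA (mulmxK uB); congr (_ *m _).
  rewrite -!mulmxA mulmx_diag; congr (_ *m diag_mx _).
  by apply/rowP=> i; rewrite !mxE exprSr.
rewrite mxtrace_mulC mulmxA (mulmxV uB) mul1mx mxtrace_diag.
by apply: eq_bigr => i _; rewrite mxE.
Qed.

(** Each eigenvalue of [x] is a power of [w], so [nu] raises it to the k-th power, and this gives
    the eigenvalues of [x ^+ k]. *)
Lemma aut_char_expg (nu : {rmorphism algC -> algC}) n w k :
  n.-primitive_root w -> nu w = w ^+ k -> (#|G| %| n)%N ->
  forall (phi : 'CF(G)) x, phi \is a character -> x \in G ->
  nu (phi x) = phi (x ^+ k)%g.
Proof.
move=> pr_w nuw dv_n phi x Nphi Gx; have [f [e [e1 _ De]]] := char_roots Nphi Gx.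
rewrite -[x in LHS]expg1 !De rmorph_sum; apply: eq_bigr => i _.
rewrite expr1; have en1 : e i ^+ n = 1.
  by have /dvdnP[q ->] := dvdn_trans (order_dvdG Gx) dv_n; rewrite mulnC exprM e1 expr1n.
by have [j ->] := prim_rootP pr_w en1; rewrite rmorphXn nuw -!exprM mulnC.
Qed.

Lemma Qadj_char n w (phi : 'CF(G)) x : n.-primitive_root w -> (#|G| %| n)%N ->
  phi \is a character -> Qadj w (phi x).
Proof.
move=> pr_w dv_n Nphi; have [Gx | /cfun0->] := boolP (x \in G); last exact: Qadj0.
have [f [e [e1 _ De]]] := char_roots Nphi Gx.
rewrite -[x]expg1 De; apply: Qadj_sum => i _; rewrite expr1.
apply: (Qadj_unity_root pr_w).
by have /dvdnP[q ->] := dvdn_trans (order_dvdG Gx) dv_n; rewrite mulnC exprM e1 expr1n.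
Qed.

End CharRing.

Section RelativeTrace.

Variables (n : nat) (w : algC).
Hypothesis pr_w : n.-primitive_root w.
Variables (gT : finGroupType) (G : {group gT}).
Hypothesis dv_n : (#|G| %| n)%N.

(** Here nu(chi(x^-1)) is the conjugate of chi(x^k), so this is the second orthogonality relation
    for x and x^k, which are conjugate exactly when [nu] fixes the column of [x]. *)
Lemma aut_column_orthogonality (nu : {rmorphism algC -> algC}) x : x \in G ->
  \sum_i 'chi[G]_i x * nu ('chi_i x^-1%g) =
    #|('C_G[x])%g|%:R *+ [forall i : Iirr G, nu ('chi_i x) == 'chi_i x].
Proof.
move=> Gx; have [k _ nuw] := aut_prim_rootP nu pr_w.
have nuE := aut_char_expg pr_w nuw dv_n.
transitivity (\sum_i 'chi[G]_i x * ('chi_i (x ^+ k)%g)^*).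
  by apply: eq_bigr => i _; rewrite irr_inv -conjC_irrAut nuE ?irr_char.
rewrite second_orthogonality_relation ?groupX //; congr (_ *+ (nat_of_bool _)).
apply/idP/forallP=> [/(eq_irr_mem_classP _ (groupX k Gx)) eqx i | eqx].
  by rewrite nuE ?irr_char // -eqx.
by apply/(eq_irr_mem_classP _ (groupX k Gx)) => i; rewrite -nuE ?irr_char // (eqP (eqx i)).
Qed.

(* By column orthogonality only the trivial coset contributes to the trace of [z] times the sum
   of the [chi(x) (t j) (chi(x^-1))]. *)
Lemma relative_trace (S : seq algC) x : x \in G ->
    (forall y, y \in S -> Qadj w y) ->
  exists (I : finType) (t : I -> {rmorphism algC -> algC}),
    forall z, Qadj w z ->
      (forall nu : {rmorphism algC -> algC}, {in S, forall y, nu y = y} ->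
        (forall i, nu ('chi[G]_i x) = 'chi_i x) -> nu z = z) ->
    (forall i (nu : {rmorphism algC -> algC}), {in S, forall y, nu y = y} ->
       nu (\sum_j t j (z * 'chi[G]_i x^-1%g)) = \sum_j t j (z * 'chi_i x^-1%g)) /\
    #|('C_G[x])%g|%:R * z = \sum_i \sum_j t j (z * 'chi[G]_i x^-1%g) * 'chi_i x.
Proof.
move=> Gx QS; pose X := [seq 'chi[G]_i x | i : Iirr G].
have QX y : y \in X -> Qadj w y.
  by case/imageP=> i _ ->; apply: Qadj_char pr_w dv_n (irr_char i).
have fixX (nu : {rmorphism algC -> algC}) :
    {in X, forall y, nu y = y} <-> (forall i, nu ('chi[G]_i x) = 'chi_i x).
  split=> [fix_nu i | fix_nu _ /imageP[i _ ->] //].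
  by apply/fix_nu/imageP; exists i.
have [I [i0 [t [[t0X t0Q] tX tr_t]]]] := relative_transversal pr_w QS QX.
exists I, t => z Qz fix_z; split=> [i nu fix_nu | ].
  apply: tr_t fix_nu => [|mu fixS_mu /fixX fix_mu].
    by apply: QadjM Qz _; apply: Qadj_char pr_w dv_n (irr_char i).
  by rewrite rmorphM fix_z // irr_inv -conjC_irrAut fix_mu.
transitivity (\sum_j t j z * \sum_i 'chi[G]_i x * t j ('chi_i x^-1%g)); last first.
  rewrite exchange_big; apply: eq_bigr => j _; rewrite mulr_sumr.
  by apply: eq_bigr => i _; rewrite rmorphM (mulrC ('chi_i x)) mulrA.
rewrite (bigD1 i0) //= [X in _ + X]big1 => [|j neq_j]; last first.
  have [y Xy ty] := tX j neq_j.
  rewrite aut_column_orthogonality // (_ : [forall i, _] = false) ?mulr0 //.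
  apply: contraNF ty => /forallP fix_t; apply/eqP.
  by apply: (iffRL (fixX (t j))) => // i; apply/eqP/fix_t.
rewrite addr0 aut_column_orthogonality // t0Q // (_ : [forall i, _]) ?mulr1n 1?mulrC //.
by apply/forallP=> i; apply/eqP/(iffLR (fixX (t i0)) t0X).
Qed.

End RelativeTrace.

Definition fixes_chars (gT : finGroupType) (G : {group gT}) (nu : {rmorphism algC -> algC}) :=
  forall i x, nu ('chi[G]_i x) = 'chi_i x.

Definition cyclo_int_fixed (w : algC) (gT : finGroupType) (G : {group gT}) (z : algC) :=
  [/\ Qadj w z, z \in Aint &
   forall nu : {rmorphism algC -> algC}, fixes_chars G nu -> nu z = z].

(* Each use of [relative_trace] removes one group element from the values that [z] depends on. *)
Lemma char_ring_exp_card n w (gT : finGroupType) (G : {group gT}) z :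
    n.-primitive_root w -> (#|G| %| n)%N -> cyclo_int_fixed w G z ->
  exists k, char_ring G (#|G|%:R ^+ k * z).
Proof.
move=> pr_w dv_n [Qz Az fix_z].
pose fixes (s : seq gT) (nu : {rmorphism algC -> algC}) :=
  forall x, x \in s -> forall i, nu ('chi[G]_i x) = 'chi_i x.
have {}fix_z (nu : {rmorphism algC -> algC}) : fixes (enum G) nu -> nu z = z.
  move=> fix_nu; apply: fix_z => i x; have [Gx | /cfun0->] := boolP (x \in G).
    by apply: fix_nu; rewrite mem_enum.
  by rewrite rmorph0.
have sG : {subset enum G <= G} by move=> x; rewrite mem_enum.
elim: (enum G) sG z Qz Az fix_z => [|x s IHs] sG z Qz Az fix_z.
  exists 0; rewrite mul1r; apply: char_ring_Cint.
  by apply: (Qadj_aut_int pr_w) => // nu; apply: fix_z.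
have Gx : x \in G by rewrite sG ?mem_head.
pose S := [seq 'chi[G]_i y | y <- s, i <- enum (Iirr G)].
have QS y : y \in S -> Qadj w y.
  by case/allpairsP=> [[a i] [_ _ ->]]; apply: Qadj_char pr_w dv_n (irr_char i).
have fixS (nu : {rmorphism algC -> algC}) : {in S, forall y, nu y = y} -> fixes s nu.
  move=> fix_nu y sy i; apply/fix_nu/allpairsP; exists (y, i).
  by rewrite mem_enum.
have SfixS (nu : {rmorphism algC -> algC}) : fixes s nu -> {in S, forall y, nu y = y}.
  by move=> fix_nu _ /allpairsP[[y i] [sy _ ->]]; apply: fix_nu.
have [I [t tr_t]] := relative_trace pr_w dv_n Gx QS.
have [|tr_fix tr_sum] := tr_t z Qz.
  move=> nu /fixS fix_s fix_x; apply: fix_z => y; rewrite inE => /predU1P[-> //|].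
  exact: fix_s.
have /fin_all_exists[k Dk] i : exists k,
    char_ring G (#|G|%:R ^+ k * \sum_j t j (z * 'chi[G]_i x^-1%g)).
  apply: IHs => [y sy | | | nu /SfixS]; last exact: tr_fix.
  - by rewrite sG // inE sy orbT.
  - apply: Qadj_sum => j _; apply: (aut_Qadj_prim _ pr_w).
    by apply: QadjM Qz _; apply: Qadj_char pr_w dv_n (irr_char i).
  by rewrite rpred_sum // => j _; rewrite Aint_aut rpredM ?Aint_irr.
exists (\sum_i k i).+1.
have -> : #|G|%:R ^+ (\sum_i k i).+1 * z =
    #|G : 'C_G[x]|%g%:R * (#|G|%:R ^+ (\sum_i k i) * (#|('C_G[x])%g|%:R * z)).
  rewrite exprSr -{2}(Lagrange (subsetIl G 'C[x]%g)) natrM.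
  by rewrite -!mulrA [RHS]mulrCA; congr (_ * _); rewrite [RHS]mulrCA.
apply: char_ringM; first exact: char_ring_nat.
rewrite tr_sum mulr_sumr; apply: char_ring_sum => i _.
rewrite -mulr_suml mulrA; apply: char_ringM; last exact: char_ring_irr.
rewrite (bigD1 i) //= addnC exprD -mulrA; apply: char_ringM (Dk i).
by rewrite -natrX; apply: char_ring_nat.
Qed.

(** * Congruences modulo p between algebraic integers *)

Lemma exprDp_eqAmod p u v : prime p -> u \in Aint -> v \in Aint ->
  ((u + v) ^+ p == u ^+ p + v ^+ p %[mod p])%A.
Proof.
move=> pr_p Au Av; have p_gt0 := prime_gt0 pr_p; rewrite exprDn.
rewrite -(prednK p_gt0) big_ord_recl big_ord_recr /= bin0 mulr1n subn0 expr0 mulr1.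
rewrite /bump /= add1n subnn binn expr0 mul1r mulr1n prednK //.
rewrite eqAmodDl -{2}[v ^+ p]add0r eqAmodDr eqAmod0.
apply: rpred_sum => i _; rewrite add1n -mulr_natr.
have /dvdnP[q ->] : (p %| 'C(p, i.+1))%N by rewrite prime_dvd_bin // -ltn_predRL ltn_ord.
by rewrite natrM mulrA -eqAmod0 eqAmodMl0 // rpredM ?rpredM ?rpredX ?rpred_nat.
Qed.

Lemma exp_1subr_eqAmod p N u : prime p -> odd p -> u \in Aint ->
  ((1 - u) ^+ (p ^ N) == 1 - u ^+ (p ^ N) %[mod p])%A.
Proof.
move=> pr_p odd_p Au; elim: N => [|N IHN]; first by rewrite !expn0 !expr1.
have Ak k : 1 - u ^+ k \in Aint by rewrite rpredB ?rpredX.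
have AXk k : (1 - u) ^+ k \in Aint by rewrite rpredX // rpredB.
have eqX k : ((1 - u) ^+ (p ^ N) ^+ k == (1 - u ^+ (p ^ N)) ^+ k %[mod p])%A.
  elim: k => [|k IHk]; first by rewrite !expr0.
  by rewrite !exprS; apply: eqAmodM; rewrite ?AXk ?rpredX ?Ak.
rewrite expnSr !exprM; apply: eqAmod_trans (eqX p) _.
apply: eqAmod_trans (exprDp_eqAmod pr_p _ _) _; rewrite ?rpredN ?rpredX //.
by rewrite expr1n exprNn -signr_odd odd_p mulN1r.
Qed.

Lemma dvdA_nat_exp p t k : prime p -> t \in Num.int -> (p %| t ^+ k)%A -> (p %| t)%C.
Proof.
move=> pr_p Zt; rewrite -eqAmod0 eqAmod0_rat ?rpred_nat ?rpredX ?Crat_rat //; last first.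
  by case/intrP: Zt => m ->; rewrite rpred_int.
case/intrP: Zt => m ->; rewrite -rmorphXn /= !dvdC_int ?rpred_int // !intrKfloor.
by rewrite abszX Euclid_dvdX // => /andP[].
Qed.

Lemma pgroup_char_sub1 (p : nat) w (gT : finGroupType) (P : {group gT}) i x :
    (p.-group P)%g -> #|P|.-primitive_root w -> x \in P ->
  exists2 a, a \in Aint & 'chi[P]_i x - 'chi_i 1%g = (1 - w) * a.
Proof.
move=> pP pr_w Px; have [f [e [e1 e_f De]]] := char_roots (irr_char i) Px.
have en1 j : e j ^+ #|P| = 1.
  by have /dvdnP[q ->] := order_dvdG Px; rewrite mulnC exprM e1 expr1n.
have /fin_all_exists2[a Aa Da] j : exists2 a, a \in Aint & e j - 1 = (1 - w) * a.
  have [k ->] := prim_rootP pr_w (en1 j); exists (- \sum_(l < k) w ^+ l).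
    by rewrite rpredN rpred_sum // => l _; rewrite rpredX // (Aint_prim_root pr_w).
  by rewrite mulrN -mulNr opprB subrX1.
exists (\sum_j a j); first by rewrite rpred_sum.
rewrite mulr_sumr -(eq_bigr _ (fun j _ => Da j)) sumrB sumr_const card_ord -e_f.
by rewrite -[x in LHS]expg1 De; congr (_ - _); apply: eq_bigr => j _; rewrite expr1.
Qed.

(* The coefficients [c_chi] of [relative_trace] are integers here, and [c_chi - chi(1) c_1] is
   divisible by p, being divisible by [1 - w1] with [w1] a root of unity of p-power order. *)
Lemma pgroup_char_gain n w p (gT : finGroupType) (P : {group gT}) x z :
    n.-primitive_root w -> (#|P| %| n)%N -> prime p -> odd p -> (p.-group P)%g ->
    x \in P -> x != 1%g -> Qadj w z -> z \in Aint ->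
    (forall nu : {rmorphism algC -> algC},
       (forall i, nu ('chi[P]_i x) = 'chi_i x) -> nu z = z) ->
  char_ring P ((#|P| %/ p)%:R * z).
Proof.
move=> pr_w dv_n pr_p odd_p pP Px ntx Qz Az fix_z.
(* With [S] empty the trace goes down to Q, so the coefficients are fixed by all automorphisms. *)
have [I [t tr_t]] := relative_trace pr_w dv_n Px (fun y (s0 : y \in [::]) => False_ind _ (notF s0)).
have [|tr_fix tr_sum] := tr_t z Qz; first by move=> nu _; apply: fix_z.
pose c i := \sum_j t j (z * 'chi[P]_i x^-1%g).
(* Subtracting [c 0] times the regular character does not change the sum at x != 1, and the new
   coefficients will be multiples of p. *)
pose c' i := \sum_j t j (z * ('chi[P]_i x^-1%g - 'chi_i 1%g)).
have Dc' i : c' i = c i - 'chi_i 1%g * c 0.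
  rewrite /c' /c mulr_sumr -sumrB; apply: eq_bigr => j _.
  rewrite mulrBr rmorphB; congr (_ - _); rewrite irr0 cfun1E groupV Px mulr1.
  by rewrite rmorphM mulrC; congr (_ * _); rewrite irr1_degree rmorph_nat.
have Ac i : c i \in Aint.
  by rewrite rpred_sum // => j _; rewrite Aint_aut rpredM ?Aint_irr.
have Zc i : c i \in Num.int.
  apply: (Qadj_aut_int pr_w); last 1 first.
  - by move=> nu; apply: tr_fix.
  - apply: Qadj_sum => j _; apply: (aut_Qadj_prim _ pr_w).
    by apply: QadjM Qz _; apply: Qadj_char pr_w dv_n (irr_char i).
  exact: Ac.
have Zc' i : c' i \in Num.int.
  by rewrite Dc' rpredB ?rpredM // irr1_degree rpred_nat.
have [N cardP] := p_natP pP.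
have [w1 pr_w1] := C_prim_root_exists (cardG_gt0 P).
have p_dv i : (p %| c' i)%C.
  apply: (dvdA_nat_exp (k := #|P|)) => //.
  have [b Ab Db] : exists2 b, b \in Aint & c' i = (1 - w1) * b.
    have [a Aa Da] := pgroup_char_sub1 i pP pr_w1 (groupVr Px).
    have /fin_all_exists2[b Ab Db] j :
        exists2 b, b \in Aint & t j (z * ('chi[P]_i x^-1%g - 'chi_i 1%g)) = (1 - w1) * b.
      have [k _ tw] := aut_prim_rootP (t j) pr_w1.
      exists (t j (z * a) * \sum_(l < k) w1 ^+ l).
        rewrite rpredM ?Aint_aut ?rpredM // rpred_sum // => l _.
        by rewrite rpredX // (Aint_prim_root pr_w1).
      rewrite Da mulrCA rmorphM rmorphB rmorph1 tw mulrC mulrCA; congr (_ * _).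
      by apply: oppr_inj; rewrite opprB -mulNr opprB subrX1.
    by exists (\sum_j b j); [rewrite rpred_sum | rewrite mulr_sumr; apply: eq_bigr].
  (* Modulo p, (1 - w1)^|P| is congruent to 1 - w1^|P| = 0, so p divides a power of [c' i]. *)
  rewrite Db exprMn -eqAmod0 -[X in (_ == X %[mod _])%A](mul0r (b ^+ #|P|)).
  apply: eqAmodMr; first by rewrite rpredX.
  have := exp_1subr_eqAmod N pr_p odd_p (Aint_prim_root pr_w1).
  by rewrite -cardP (prim_expr_order pr_w1) subrr.
have p_nz : p%:R != 0 :> algC by rewrite pnatr_eq0 -lt0n prime_gt0.
have p_dvC : (p %| #|('C_P[x])%g|)%N.
  have Cx : x \in ('C_P[x])%g by rewrite inE Px cent1id.
  have ntC : 'C_P[x]%g != 1%g by apply: contraNneq ntx => C1; rewrite C1 inE in Cx.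
  by have [] := pgroup_pdiv (pgroupS (subsetIl P 'C[x]%g) pP) ntC.
have sum0 : \sum_i 'chi[P]_i 1%g * 'chi_i x = 0.
  transitivity (cfReg P x); last by rewrite cfRegE (negPf ntx) mulr0n.
  by rewrite cfReg_sum sum_cfunE; apply: eq_bigr => i _; rewrite cfunE.
have /fin_all_exists2[d Zd Dd] i : exists2 d, d \in Num.int & c' i = d * p%:R.
  by have /dvdCP[d Zd ->] := p_dv i; exists d.
have -> : (#|P| %/ p)%:R * z = #|P : 'C_P[x]|%g%:R * \sum_i d i * 'chi_i x.
  apply: (mulfI p_nz); rewrite mulrA -natrM mulnC divnK; last first.
    by apply: dvdn_trans p_dvC (cardSg (subsetIl _ _)).
  rewrite -{1}(Lagrange (subsetIl P 'C[x]%g)) natrM mulrAC tr_sum mulrC mulrCA.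
  congr (_ * _); transitivity (\sum_i c' i * 'chi_i x); last first.
    by rewrite mulr_sumr; apply: eq_bigr => i _; rewrite Dd mulrAC mulrC mulrA.
  transitivity (\sum_i \sum_j t j (z * 'chi[P]_i x^-1%g) * 'chi_i x
                - c 0 * \sum_i 'chi[P]_i 1%g * 'chi_i x); first by rewrite sum0 mulr0 subr0.
  rewrite mulr_sumr -sumrB; apply: eq_bigr => i _.
  by rewrite -mulr_suml -/(c i) Dc' mulrBl; congr (_ - _); rewrite mulrCA mulrA.
apply: char_ringM; first exact: char_ring_nat.
apply: char_ring_sum => i _; apply: char_ringM (char_ring_irr _ _).
exact: char_ring_Cint.
Qed.

(** Apart from 1, the linear term p^(j+1) u of the binomial expansion has the least p-adic
    valuation. For p = 2 this fails at j = 1, as 3^2 = 1 + 8 shows, whence j > 1. *)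
Lemma lift_exponent p j u : prime p -> ~~ (p %| u)%N -> (odd p && (0 < j) || (1 < j))%N ->
  exists2 v, ~~ (p %| v)%N & ((1 + p ^ j * u) ^ p = 1 + p ^ j.+1 * v)%N.
Proof.
move=> pr_p p'u p_j; have p_gt1 := prime_gt1 pr_p; set x := (p ^ j * u)%N.
have binE k : exists c, ((1 + x) ^ k = 1 + k * x + 'C(k, 2) * x ^ 2 + x ^ 3 * c)%N.
  elim: k => [|k [c IHk]]; first by exists 0%N; rewrite expn0 bin0n !mul0n muln0.
  exists (c * (1 + x) + 'C(k, 2))%N; rewrite expnSr {}IHk binS bin1.
  by move: ('C(k, 2)) => b; rewrite !expnS expn0; ring.
have [c Dc] := binE p.
have [q Dq] : exists q, ('C(p, 2) * x ^ 2 + x ^ 3 * c = p ^ j.+1 * (p * q))%N.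
  have [odd_p | even_p] := boolP (odd p).
    have j_gt0 : (0 < j)%N by case/orP: p_j => [/andP[] | /ltnW].
    have p_gt2 := odd_prime_gt2 odd_p pr_p.
    have /dvdnP[q0 ->] : (p %| 'C(p, 2))%N by rewrite prime_dvd_bin.
    rewrite /x; case: (j) j_gt0 => // i _; exists (q0 * p ^ i * u ^ 2 + p ^ i * p ^ i * u ^ 3 * c)%N.
    by rewrite !expnS; ring.
  have p2 : p = 2 by have [] := even_prime pr_p => // odd_p; rewrite odd_p in even_p.
  have j_gt1 : (1 < j)%N by move: p_j; rewrite (negPf even_p).
  rewrite /x p2 binn; case: (j) j_gt1 => [//|[//|i]] _.
  exists (2 ^ i * u ^ 2 + 2 ^ i * 2 ^ i * 4 * u ^ 3 * c)%N.
  by rewrite !expnS; ring.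
exists (u + p * q)%N; first by rewrite dvdn_addl ?dvdn_mulr.
by rewrite Dc -[RHS]/(_ + _)%N -!addnA Dq /x expnS; ring.
Qed.

(** Successive approximation: by [lift_exponent], a^(p^(N-j)) = 1 + p^N v with v prime to p, and a
    suitable power of it corrects a^e from modulus p^N to p^(N+1). *)
Lemma exp_generates p j u N l : prime p -> ~~ (p %| u)%N ->
    (odd p && (0 < j) || (1 < j))%N -> l = 1 %[mod p ^ j] ->
  exists e, ((1 + p ^ j * u) ^ e = l %[mod p ^ N])%N.
Proof.
move=> pr_p p'u p_j l1; have p_gt0 := prime_gt0 pr_p; set a := (1 + _)%N.
have iterE i : exists2 v, ~~ (p %| v)%N & (a ^ (p ^ i) = 1 + p ^ (j + i) * v)%N.
  elim: i => [|i [v p'v IHi]]; first by exists u; rewrite // addn0 expn1.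
  rewrite expnSr expnM IHi addnS; apply: lift_exponent => //.
  by case/orP: p_j => [/andP[-> j0] | j1]; rewrite ?addn_gt0 ?j0 // (leq_trans j1 (leq_addr _ _)) orbT.
elim: N => [|N [e IHN]]; first by exists 0%N; rewrite !modn1.
have [leNj | ltjN] := leqP N.+1 j.
  exists 0%N; have /dvdnP[q Dq] := dvdn_exp2l p leNj.
  by apply/eqP; rewrite eq_sym expn0 -(modn_dvdm l (dvdn_exp2l p leNj)) l1 modn_dvdm ?dvdn_exp2l.
have [v p'v Dv] := iterE (N - j)%N; rewrite subnKC // in Dv.
(* The term [p ^ N.+1 * a ^ e] changes no residue modulo p^(N+1) and keeps the subtraction of
   naturals exact. *)
have [t Dt] : exists t, (l + p ^ N.+1 * a ^ e = a ^ e + p ^ N * t)%N.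
  have /dvdnP[t Dt] : (p ^ N %| l + p ^ N.+1 * a ^ e - a ^ e)%N.
    rewrite -eqn_mod_dvd; last by rewrite (leq_trans _ (leq_addl _ _)) // leq_pmull ?expn_gt0 ?p_gt0.
    by rewrite IHN expnS -mulnA mulnCA addnC mulnC modnMDl.
  exists t; rewrite (mulnC _ t) -Dt subnKC //.
  by rewrite (leq_trans _ (leq_addl _ _)) // leq_pmull ?expn_gt0 ?p_gt0.
have co_av : coprime p (a ^ e * v).
  rewrite coprimeMr [coprime p v]prime_coprime // p'v andbT coprimeXr //.
    rewrite prime_coprime // /a dvdn_addl ?dvdn1 ?gtn_eqF ?prime_gt1 //.
  by rewrite dvdn_mulr // dvdn_exp //; case/orP: p_j => [/andP[] | /ltnW].
(* By Euler's theorem, b^(totient(p) - 1) inverts b modulo p, so that [f] solves b f = t. *)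
pose b := (a ^ e * v)%N; pose f := (b ^ (totient p).-1 * t)%N.
have bf : (b * f = t %[mod p])%N.
  rewrite mulnA -expnS prednK ?totient_gt0 // -modnMml Euler_exp_totient 1?coprime_sym //.
  by rewrite modnMml mul1n.
exists (e + p ^ (N - j) * f)%N; rewrite expnD expnM Dv.
have [c ->] : exists c, ((1 + p ^ N * v) ^ f = 1 + f * (p ^ N * v) + (p ^ N * v) ^ 2 * c)%N.
  elim: (f) => [|k [c IHk]]; first by exists 0%N; rewrite expn0 mul0n muln0.
  exists (c * (1 + p ^ N * v) + k)%N; rewrite expnSr {}IHk.
  by move: (p ^ N * v)%N => y; rewrite !expnS expn0; ring.
have N_gt0 : (0 < N)%N by rewrite -ltnS; apply: leq_trans ltjN; rewrite ltnS; case/orP: p_j => [/andP[] | /ltnW].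
have -> : (a ^ e * (1 + f * (p ^ N * v) + (p ^ N * v) ^ 2 * c) =
   a ^ e + p ^ N * (b * f) + a ^ e * v ^ 2 * c * p ^ N.-1 * p ^ N.+1)%N.
  by rewrite /b; case: (N) N_gt0 => // i _; rewrite !expnS; ring.
rewrite addnC modnMDl -modnDmr expnSr -muln_modr bf muln_modr -expnSr modnDmr -Dt.
by rewrite addnC mulnC modnMDl.
Qed.

(** * Groups of odd prime power order, and direct products *)

Section OddPgroup.

Variables (n : nat) (w : algC) (p : nat) (gT : finGroupType) (P : {group gT}).
Hypotheses (pr_w : n.-primitive_root w) (dv_n : (#|P| %| n)%N).
Hypotheses (pr_p : prime p) (odd_p : odd p) (pP : (p.-group P)%g).

Lemma class_expg_iter (G : {group gT}) y k e : y \in G ->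
  (y ^+ k)%g \in (y ^: G)%g -> (y ^+ (k ^ e))%g \in (y ^: G)%g.
Proof.
move=> Gy /imsetP[g Gg Dyk]; apply/imsetP; exists (g ^+ e)%g; first exact: groupX.
elim: e => [|e IHe]; first by rewrite conjg1.
by rewrite expnSr expgM IHe -conjXg Dyk -conjgM -expgS.
Qed.

(** Conjugation by [g] raises [y0], of order p, to the power k. As [g] has p-power order, k^(p^N) =
    1 modulo p, while k^(p^N) = k by Fermat. *)
Lemma pgroup_conj_exp_mod1 y k : y \in P -> y != 1%g ->
  (y ^+ k)%g \in (y ^: P)%g -> k = 1 %[mod p].
Proof.
move=> Py nty /imsetP[g Pg Dyk].
have [_ p_dv_y _] : [/\ prime p, (p %| #[y]%g)%N & exists m, #[y]%g = (p ^ m.+1)%N].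
  by apply: pgroup_pdiv; [apply: mem_p_elt pP Py | rewrite cycle_eq1].
pose y0 := (y ^+ (#[y]%g %/ p)%N)%g.
have oy0 : #[y0]%g = p by rewrite orderXdiv ?dvdn_div // divnA ?mulKn ?order_gt0.
have Dy0 e : (y0 ^+ (k ^ e) = y0 ^ (g ^+ e))%g.
  elim: e => [|e IHe]; first by rewrite conjg1.
  rewrite expnSr expgM IHe -conjXg expgS conjgM; congr (_ ^ _)%g.
  by rewrite /y0 -expgM mulnC expgM Dyk conjXg.
have [N cardP] := p_natP pP.
have : (y0 ^+ (k ^ #|P|) == y0 ^+ 1)%g by rewrite Dy0 (expg_cardG) // conjg1.
rewrite eq_expg_mod_order oy0 cardP => /eqP <-.
elim: N {cardP} => [|N IHN]; first by rewrite expn0 expn1.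
by rewrite expnSr expnM fermat_little.
Qed.

(* [B y j] says that [y] is conjugate to all [y ^+ k] with k = 1 mod p^j; [x] maximizes the
   least such j. *)
Lemma odd_pgroup_full_elt :
  exists2 x, x \in P & (P :!=: 1%g -> x != 1%g) /\
    forall nu : {rmorphism algC -> algC},
      (forall i, nu ('chi[P]_i x) = 'chi_i x) -> fixes_chars P nu.
Proof.
have fix1 (nu : {rmorphism algC -> algC}) i : nu ('chi[P]_i 1%g) = 'chi_i 1%g.
  by rewrite irr1_degree rmorph_nat.
have [P1 | ntP] := eqVneq (gval P) 1%g.
  exists 1%g => //; split=> [//|nu fix_nu i y].
  have [Py | /cfun0->] := boolP (y \in P); last by rewrite rmorph0.
  by have -> : y = 1%g by apply/set1gP; rewrite -P1.
have [N cardP] := p_natP pP.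
have expN y k : y \in P -> (y ^+ (k %% p ^ N))%g = (y ^+ k)%g.
  by move=> Py; rewrite expg_mod // -cardP expg_cardG.
pose B y j := [forall k : 'I_(p ^ N), (k == 1 %[mod p ^ j])%N ==> ((y ^+ k)%g \in (y ^: P)%g)].
have BP y j : y \in P -> (j <= N)%N -> reflect
    (forall k, k = 1 %[mod p ^ j] -> (y ^+ k)%g \in (y ^: P)%g) (B y j).
  move=> Py lejN; apply: (iffP forallP) => [By k k1 | By k]; last first.
    by apply/implyP=> /eqP/By.
  have pN_gt0 : (0 < p ^ N)%N by rewrite expn_gt0 prime_gt0.
  have := By (Ordinal (ltn_pmod k pN_gt0)); rewrite /= expN //.
  by rewrite modn_dvdm ?dvdn_exp2l // k1 eqxx.
have BN y : y \in P -> B y N.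
  move=> Py; apply/BP => // k k1.
  by rewrite -expN // k1 expN // expg1 class_refl.
have exB y : exists j, (y \in P) ==> B y j.
  by exists N; apply/implyP => /BN.
pose J y := ex_minn (exB y).
have BJ y : y \in P -> B y (J y).
  by move=> Py; rewrite /J; case: ex_minnP => j; rewrite Py.
have leJ y j : y \in P -> B y j -> (J y <= j)%N.
  by move=> Py Bj; rewrite /J; case: ex_minnP => j' _; apply; rewrite Py.
have [x0 Px0 ntx0] := trivgPn _ ntP.
pose D := [pred x | (x \in P) && (x != 1%g)].
have Dx0 : D x0 by rewrite /= Px0.
case: (@arg_maxnP _ x0 D J Dx0) => x /andP[Px ntx] maxx.
exists x => //; split=> // nu fix_nu i y.
have [Py | /cfun0->] := boolP (y \in P); last by rewrite rmorph0.
have [-> // | nty] := eqVneq y 1%g.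
have [k _ nuw] := aut_prim_rootP nu pr_w.
have nuE := aut_char_expg pr_w nuw dv_n.
have xk : (x ^+ k)%g \in (x ^: P)%g.
  by apply/(eq_irr_mem_classP _ Px) => j; rewrite -nuE ?irr_char.
suffices yk : (y ^+ k)%g \in (y ^: P)%g.
  by rewrite nuE ?irr_char //; apply/(eq_irr_mem_classP _ Py).
have k1 := pgroup_conj_exp_mod1 Px ntx xk.
have k_gt0 : (0 < k)%N.
  by rewrite lt0n; apply: contra_eq_neq k1 => ->; rewrite mod0n modn_small ?prime_gt1.
have [k_1 | k'1] := eqVneq k 1%N; first by rewrite k_1 expg1 class_refl.
have k1_gt0 : (0 < k.-1)%N by case: (k) k_gt0 k'1 => [|[]].
have [u p'u Dk] := pfactor_coprime pr_p k1_gt0; set j := logn p k.-1 in Dk.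
have j_gt0 : (0 < j)%N.
  rewrite logn_gt0 mem_primes pr_p k1_gt0 -subn1 -eqn_mod_dvd //.
  exact/eqP.
have {}Dk : (k = 1 + p ^ j * u)%N by rewrite mulnC -Dk add1n prednK.
have [lejN | ltNj] := leqP j N.
  (* As k = 1 + p^j u with u prime to p, its powers exhaust the residues that are 1 modulo p^j; so
     [x] is conjugate to all these powers of [x], and [J x] is at most j. By maximality so is
     [J y]. *)
  have Bxj : B x j.
    apply/BP => // l l1.
    have [||e De] := exp_generates (u := u) N pr_p _ _ l1.
    - by rewrite -prime_coprime.
    - by rewrite odd_p j_gt0.
    by rewrite -expN // -De -Dk expN // class_expg_iter.
  have leJj : (J y <= j)%N.
    by apply: leq_trans (leJ x j Px Bxj); apply: maxx; rewrite /= Py.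
  have JN : (J y <= N)%N by apply: leJ (BN y Py).
  apply: (BP _ _ Py JN (BJ y Py)).
  by rewrite Dk -(subnKC leJj) expnD -mulnA addnC mulnC modnMDl.
have := BP _ _ Py (leqnn N) (BN y Py); apply.
by rewrite Dk -(subnKC (ltnW ltNj)) expnD -mulnA addnC mulnC modnMDl.
Qed.

End OddPgroup.

Section DirectProduct.

Variables (gT : finGroupType) (G K H : {group gT}).
Hypothesis KxH : (K \x H = G)%g.

Lemma char_ring_dprodl z : char_ring K z -> char_ring G z.
Proof.
elim=> [_ [i [g [Kg ->]]] | | x y _ Rx _ Ry | x y _ Rx _ Ry].
- rewrite -(cfDprodEl KxH _ Kg (group1 H)); apply: char_ring_char.
  by rewrite cfDprodl_char irr_char.
- exact: char_ring1.
- exact: char_ringB.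
exact: char_ringM.
Qed.

Lemma char_ring_dprodr z : char_ring H z -> char_ring G z.
Proof.
elim=> [_ [i [g [Hg ->]]] | | x y _ Rx _ Ry | x y _ Rx _ Ry].
- rewrite -(cfDprodEr KxH _ (group1 K) Hg); apply: char_ring_char.
  by rewrite cfDprodr_char irr_char.
- exact: char_ring1.
- exact: char_ringB.
exact: char_ringM.
Qed.

Lemma fixes_chars_dprod nu : fixes_chars K nu -> fixes_chars H nu -> fixes_chars G nu.
Proof.
move=> fixK fixH k g; have [Gg | /cfun0->] := boolP (g \in G); last by rewrite rmorph0.
have [x [y [Kx Hy -> _]]] := mem_dprod KxH Gg.
have [[i j] ->] : exists ij, k = dprod_Iirr KxH ij.
  by exists (inv_dprod_Iirr KxH k); rewrite inv_dprod_IirrK.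
by rewrite dprod_IirrE cfDprodE // rmorphM fixK fixH.
Qed.

(** The trace is taken relative to Q(H), at [x] in [K]. By [full_x] every element of Q(G) is
    admissible, and the coefficients are integers of Q(H), to which [kill_H] applies. *)
Lemma char_ring_dprod_step n w x m z :
    n.-primitive_root w -> (#|G| %| n)%N -> x \in K ->
    (forall nu : {rmorphism algC -> algC},
      (forall i, nu ('chi[K]_i x) = 'chi_i x) -> fixes_chars K nu) ->
    (forall c, cyclo_int_fixed w H c -> char_ring H (m%:R * c)) ->
  cyclo_int_fixed w G z -> char_ring G ((#|('C_K[x])%g| * m)%:R * z).
Proof.
move=> pr_w dv_n Kx full_x kill_H [Qz Az fix_z].
have [_ mulKH _ _] := dprodP KxH.
have dv_K : (#|K| %| n)%N.
  by apply: dvdn_trans dv_n; rewrite -(dprod_card KxH) dvdn_mulr.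
have dv_H : (#|H| %| n)%N.
  by apply: dvdn_trans dv_n; rewrite -(dprod_card KxH) dvdn_mull.
pose S := [seq 'chi[H]_i y | y <- enum H, i <- enum (Iirr H)].
have QS y : y \in S -> Qadj w y.
  by case/allpairsP=> [[a i] [_ _ ->]]; apply: Qadj_char pr_w dv_H (irr_char i).
have fixS (nu : {rmorphism algC -> algC}) : {in S, forall y, nu y = y} <-> fixes_chars H nu.
  split=> [fix_nu i y | fix_nu _ /allpairsP[[y i] [_ _ ->]]]; last exact: fix_nu.
  have [Hy | /cfun0->] := boolP (y \in H); last by rewrite rmorph0.
  by apply/fix_nu/allpairsP; exists (y, i); rewrite !mem_enum.
have [I [t tr_t]] := relative_trace pr_w dv_K Kx QS.
have [|tr_fix tr_sum] := tr_t z Qz.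
  by move=> nu /fixS fixH /full_x fixK; apply/fix_z/fixes_chars_dprod.
rewrite natrM mulrAC tr_sum mulr_suml; apply: char_ring_sum => i _.
rewrite -mulr_suml mulrAC; apply: char_ringM; last exact/char_ring_dprodl/char_ring_irr.
apply: char_ring_dprodr; rewrite mulrC; apply: kill_H; split=> [||nu /fixS]; last exact: tr_fix.
  apply: Qadj_sum => j _; apply: (aut_Qadj_prim _ pr_w).
  by apply: QadjM Qz _; apply: Qadj_char pr_w dv_K (irr_char i).
by rewrite rpred_sum // => j _; rewrite Aint_aut rpredM ?Aint_irr.
Qed.

End DirectProduct.

(** * Norms in the ring of integers of a 2-power cyclotomic field *)

Definition ieval (P : {poly int}) (t : algC) : algC := (map_poly intr P).[t].

Section Ieval.
Variable t : algC.

Lemma ievalD P Q : ieval (P + Q) t = ieval P t + ieval Q t.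
Proof. by rewrite /ieval rmorphD hornerD. Qed.

Lemma ievalB P Q : ieval (P - Q) t = ieval P t - ieval Q t.
Proof. by rewrite /ieval rmorphB hornerD hornerN. Qed.

Lemma ievalM P Q : ieval (P * Q) t = ieval P t * ieval Q t.
Proof. by rewrite /ieval rmorphM hornerM. Qed.

Lemma ievalX k : ieval 'X^k t = t ^+ k.
Proof. by rewrite /ieval map_polyXn hornerXn. Qed.

Lemma ievalX1 : ieval 'X t = t.
Proof. by rewrite /ieval map_polyX hornerX. Qed.

Lemma ieval1X : ieval (1 - 'X) t = 1 - t.
Proof. by rewrite ievalB ievalX1 /ieval rmorph1 hornerC. Qed.

Lemma ievalC c : ieval c%:P t = c%:~R.
Proof. by rewrite /ieval map_polyC hornerC. Qed.

Lemma ieval1 : ieval 1 t = 1. Proof. exact: ievalC. Qed.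

Lemma ieval_exp P k : ieval (P ^+ k) t = ieval P t ^+ k.
Proof. by rewrite /ieval rmorphXn horner_exp. Qed.

Lemma ieval_Xn1 k : t ^+ k = -1 -> ieval ('X^k + 1) t = 0.
Proof. by rewrite ievalD ievalX ieval1 => ->; rewrite addNr. Qed.

Lemma ieval_sum (I : Type) (s : seq I) (P : pred I) F :
  ieval (\sum_(i <- s | P i) F i) t = \sum_(i <- s | P i) ieval (F i) t.
Proof. by rewrite /ieval rmorph_sum horner_sum. Qed.

Lemma Aint_ieval P : t \in Aint -> ieval P t \in Aint.
Proof.
move=> At; rewrite /ieval horner_coef rpred_sum // => i _.
by rewrite coef_map rpredM ?rpredX ?Aint_int.
Qed.

End Ieval.

Lemma ieval_comp_sqr P t : ieval (P \Po 'X^2) t = ieval P (t ^+ 2).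
Proof. by rewrite /ieval map_comp_poly horner_comp map_polyXn hornerXn. Qed.

Lemma aut_ieval (nu : {rmorphism algC -> algC}) P t : nu (ieval P t) = ieval P (nu t).
Proof.
rewrite /ieval -horner_map -map_poly_comp; congr _.[_].
by apply: eq_map_poly => c /=; rewrite rmorph_int.
Qed.

(* The resultant of P with X^(2^r) + 1, computed by induction from P(X)P(-X) = P1(X^2). *)
Fixpoint pnorm r (P : {poly int}) : int :=
  if r is r'.+1 then pnorm r' (even_poly P ^+ 2 - 'X * odd_poly P ^+ 2) else P.[-1].

(** The roots of X^(2^r) + 1, that is, the primitive 2^(r+1)-th roots of 1, by repeated square roots
    of -1. *)
Fixpoint nroots r : seq algC :=
  if r is r'.+1 then [seq sqrtC t | t <- nroots r'] ++ [seq - sqrtC t | t <- nroots r']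
  else [:: -1].

Lemma size_nroots r : size (nroots r) = (2 ^ r)%N.
Proof. by elim: r => //= r IHr; rewrite size_cat !size_map IHr expnS mul2n addnn. Qed.

Lemma nrootsP r t : reflect (t ^+ (2 ^ r) = -1) (t \in nroots r).
Proof.
elim: r t => [|r IHr] t; first by rewrite inE expr1; apply: eqP.
rewrite /= mem_cat expnS exprM; apply: (iffP idP) => [|/IHr rt2].
  by case/orP=> /mapP[s /IHr <- ->]; rewrite ?sqrrN sqrtCK.
have: (t == sqrtC (t ^+ 2)) || (t == - sqrtC (t ^+ 2)) by rewrite -eqf_sqr sqrtCK.
by case/orP=> /eqP Dt; apply/orP; [left | right]; apply/mapP; exists (t ^+ 2).
Qed.

Lemma ieval_even_odd P s :
  ieval (even_poly P ^+ 2 - 'X * odd_poly P ^+ 2) (s ^+ 2) = ieval P s * ieval P (- s).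
Proof.
have iP u : ieval P u = ieval (even_poly P) (u ^+ 2) + ieval (odd_poly P) (u ^+ 2) * u.
  by rewrite -{1}(poly_even_odd P) ievalD ievalM !ieval_comp_sqr ievalX1.
rewrite !iP sqrrN ievalB [ieval ('X * _) _]ievalM !ieval_exp ievalX1.
by move: (ieval _ _) (ieval _ _) => a b; ring.
Qed.

Lemma pnormE r P : (pnorm r P)%:~R = \prod_(t <- nroots r) ieval P t.
Proof.
elim: r P => [|r IHr] P /=.
  by rewrite big_seq1 /ieval -[-1 in RHS](rmorphN1 (intr : int -> algC)) (horner_map (intr : int -> algC)).
rewrite IHr big_cat !big_map /= -big_split /=; apply: eq_big_seq => t _.
by rewrite -ieval_even_odd sqrtCK.
Qed.

Lemma pnorm_mod r P Q : (forall t, t \in nroots r -> ieval P t = ieval Q t) ->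
  pnorm r P = pnorm r Q.
Proof. by move=> eqPQ; apply: (@intr_inj algC); rewrite !pnormE; apply: eq_big_seq. Qed.

Lemma pnormM r P Q : pnorm r (P * Q) = pnorm r P * pnorm r Q.
Proof.
apply: (@intr_inj algC); rewrite rmorphM /= !pnormE -big_split /=.
by apply: eq_bigr => t _; rewrite ievalM.
Qed.

Lemma pnorm_const r (c : int) : pnorm r c%:P = c ^+ (2 ^ r).
Proof.
apply: (@intr_inj algC); rewrite pnormE rmorphXn /=.
rewrite (eq_bigr (fun => c%:~R)) => [|t _]; last exact: ievalC.
by rewrite big_const_seq count_predT size_nroots -Monoid.iteropE.
Qed.

(** One step of the recursion replaces 1 - X by itself, since (1 - X)(1 + X) = 1 - X^2; at r = 0 the
    value at -1 is 2. *)
Lemma pnorm_1X r : pnorm r (1 - 'X) = 2.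
Proof.
elim: r => [|r IHr]; first by rewrite /= !hornerE.
rewrite /= -{}[RHS]IHr; congr (pnorm r _).
have -> : even_poly (1 - 'X : {poly int}) = 1.
  by apply/polyP=> i; rewrite coef_even_poly coefB !coef1 coefX; case: i => [|i]; rewrite ?subr0 // doubleS subr0.
have -> : odd_poly (1 - 'X : {poly int}) = -1.
  by apply/polyP=> i; rewrite coef_odd_poly coefB coefN !coef1 coefX; case: i => [|i]; rewrite ?sub0r.
by rewrite sqrrN expr1n mulr1.
Qed.

(** The cofactor [Q] is built along the recursion: P(-X) times the cofactor of P1 taken at X^2. *)
Lemma pnorm_adjoint r P : exists Q R, Q * P = (pnorm r P)%:P + ('X^(2 ^ r) + 1) * R.
Proof.
elim: r P => [|r IHr] P.
  have /factor_theorem[R DR] : root (P - P.[-1]%:P) (-1) by rewrite rootE !hornerE subrr.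
  exists 1, R; rewrite mul1r -[LHS](subrK (P.[-1]%:P)) DR addrC; congr (_ + _).
  by rewrite mulrC rmorphN opprK expn0 expr1.
have [Q [R DQR]] := IHr (even_poly P ^+ 2 - 'X * odd_poly P ^+ 2).
pose A := even_poly P \Po 'X^2; pose B := odd_poly P \Po 'X^2.
exists ((Q \Po 'X^2) * (A - B * 'X)), (R \Po 'X^2); rewrite /=.
have : (Q \Po 'X^2) * ((even_poly P ^+ 2 - 'X * odd_poly P ^+ 2) \Po 'X^2) =
    (pnorm r.+1 P)%:P + (('X^(2 ^ r) + 1) \Po 'X^2) * (R \Po 'X^2).
  by rewrite -comp_polyM DQR comp_polyD comp_polyC comp_polyM.
have -> : ('X^(2 ^ r) + 1 : {poly int}) \Po 'X^2 = 'X^(2 ^ r.+1) + 1.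
  by rewrite comp_polyD rmorphXn /= comp_polyX -exprM -expnS -polyC1 comp_polyC.
have -> : (even_poly P ^+ 2 - 'X * odd_poly P ^+ 2) \Po 'X^2 = A ^+ 2 - 'X^2 * B ^+ 2.
  by rewrite comp_polyB [X in _ - X]comp_polyM comp_polyX !rmorphXn.
have DP : P = A + B * 'X by rewrite /A /B poly_even_odd.
move=> <-; rewrite [in LHS]DP; move: (Q \Po _) A B {DP} => Q2 A B; ring.
Qed.

Lemma sqrz_parity (a : int) : exists c, a ^+ 2 = a + c * 2.
Proof.
have := divz_eq a 2; have := ltz_pmod a (isT : 0 < 2 :> int).
have := modz_ge0 a (isT : 2 != 0 :> int).
case: (a %% 2)%Z => // [[|[|//]]] _ _ ->; move: (a %/ 2)%Z => q.
  by exists (q ^+ 2 * 2 - q); ring.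
by exists (q ^+ 2 * 2 + q); ring.
Qed.

(** With E and O the even and odd parts of P, P1(1) = E(1)^2 - O(1)^2 has the parity of E(1) + O(1)
    = P(1). This reflects that 2 is totally ramified. *)
Lemma pnorm_parity r P : (2 %| pnorm r P - P.[1])%Z.
Proof.
elim: r P => [|r IHr] P /=.
  have /factor_theorem[R DR] : root (P - P.[1]%:P) 1 by rewrite rootE !hornerE subrr.
  have := congr1 (fun S => S.[-1]) DR; rewrite !hornerE => ->.
  by apply/dvdzP; exists (- R.[-1]); ring.
set E := even_poly P ^+ 2 - 'X * odd_poly P ^+ 2.
have /dvdzP[c Dc] := IHr E; apply/dvdzP.
have DE : E.[1] = (even_poly P).[1] ^+ 2 - (odd_poly P).[1] ^+ 2 by rewrite /E !hornerE.
have DP : P.[1] = (even_poly P).[1] + (odd_poly P).[1].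
  by rewrite -{1}(poly_even_odd P) !hornerE !horner_comp !hornerE expr1n.
move: Dc DE DP; move: (pnorm _ _) (even_poly P).[1] (odd_poly P).[1] => x a b Dc DE ->.
have [ca Da] := sqrz_parity a; have [cb Db] := sqrz_parity b.
exists (c + ca - cb - b); rewrite -[x](subrK E.[1]) Dc DE Da Db; ring.
Qed.

(* [U] is invertible modulo X^(2^r) + 1, so that 2 is a unit times (1 - X)^(2^r). *)
Lemma pnorm_1X_gcd r : exists U Q R e, [/\ (1 - 'X) ^+ (2 ^ r) = ('X^(2 ^ r) + 1) + U *+ 2,
  Q * U = e%:P + ('X^(2 ^ r) + 1) * R & `|e|%N = 1%N].
Proof.
have [U DU] : exists U : {poly int}, (1 - 'X) ^+ (2 ^ r) = ('X^(2 ^ r) + 1) + U *+ 2.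
  elim: r => [|r [U IHr]]; first by exists (- 'X); rewrite expn0 !expr1; ring.
  exists ('X^(2 ^ r) + U *+ 2 * ('X^(2 ^ r) + 1) + U ^+ 2 *+ 2).
  by rewrite expnS mulnC !exprM IHr; move: ('X^(2 ^ r)) => Y; ring.
have [Q [R DQ]] := pnorm_adjoint r U; exists U, Q, R, (pnorm r U); split=> //.
(* Comparing norms, 2^(2^r) = 2^(2^r) N(U), so that N(U) = 1. *)
have : pnorm r ((1 - 'X) ^+ (2 ^ r)) = pnorm r (2%:P * U).
  apply: pnorm_mod => t /nrootsP rt; rewrite DU ievalD ieval_Xn1 // add0r.
  by rewrite mulr2n ievalD ievalM ievalC; ring.
have -> : pnorm r ((1 - 'X) ^+ (2 ^ r)) = 2 ^+ (2 ^ r).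
  elim: (2 ^ r)%N => [|k IHk]; last by rewrite !exprS pnormM IHk pnorm_1X.
  by rewrite !expr0 -polyC1 pnorm_const expr1n.
rewrite pnormM pnorm_const -{1}[2 ^+ _]mulr1 => /mulfI <- //.
by rewrite expf_neq0.
Qed.

(** As X^(2^r) + 1 takes the value 2 at 1, subtracting c times it from P makes 1 a root. *)
Lemma root_factor1 P (c : int) r : P.[1] = c * 2 ->
  exists S, P = (1 - 'X) * S + ('X^(2 ^ r) + 1) * c%:P.
Proof.
move=> P1; have /factor_theorem[S DS] : root (P - ('X^(2 ^ r) + 1) * c%:P) 1.
  by rewrite rootE !hornerE expr1n P1; apply/eqP; ring.
by exists (- S); rewrite -[LHS](subrK (('X^(2 ^ r) + 1) * c%:P)) DS rmorph1; ring.
Qed.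

(** While the norm is even, so is P(1), and a factor 1 - X, of norm 2, splits off; once the norm is
    odd, it is itself the multiple of P sought, by [pnorm_adjoint]. *)
Lemma pnorm_extract r P : pnorm r P != 0 ->
  exists e Q R M, [/\ ~~ (2 %| M)%Z, `|pnorm r P|%N = (2 ^ e * `|M|)%N
    & Q * P = (1 - 'X) ^+ e * M%:P + ('X^(2 ^ r) + 1) * R].
Proof.
have [m] := ubnP `|pnorm r P|%N; elim: m P => // m IHm P ltPm nzP.
have [ev | od] := boolP (2 %| pnorm r P)%Z; last first.
  have [Q [R DQ]] := pnorm_adjoint r P; exists 0%N, Q, R, (pnorm r P).
  by rewrite expn0 mul1n expr0 mul1r.
have /dvdzP[c P1] : (2 %| P.[1])%Z by rewrite -[P.[1]](subKr (pnorm r P)) rpredB // pnorm_parity.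
have [S DS] := root_factor1 r P1.
have DnP : pnorm r P = 2 * pnorm r S.
  rewrite -(pnorm_1X r) -pnormM; apply: pnorm_mod => t /nrootsP rt.
  by rewrite DS ievalD [ieval (_ * c%:P) _]ievalM ieval_Xn1 // mul0r addr0.
have nzS : pnorm r S != 0 by move: nzP; rewrite DnP mulf_eq0 => /norP[].
have [|e [Q [R [M [oddM DnS DQ]]]]] := IHm S _ nzS.
  rewrite -ltnS (leq_ltn_trans _ ltPm) // DnP abszM ltn_Pmull //.
  by rewrite absz_gt0.
exists e.+1, Q, ((1 - 'X) * R + Q * c%:P), M; split=> //.
  by rewrite DnP abszM DnS expnS mulnA.
by rewrite DS mulrDr mulrCA DQ exprS; ring.
Qed.

Lemma prod_norm_le (s : seq algC) (F : algC -> algC) b :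
  (forall t, t \in s -> `|F t| <= b) -> \prod_(t <- s) `|F t| <= b ^+ size s.
Proof.
elim: s => [|t s IHs] leFb; first by rewrite big_nil.
rewrite big_cons exprS ler_pM ?prodr_ge0 ?leFb ?mem_head // IHs // => u su.
by rewrite leFb // inE su orbT.
Qed.

(* The bound forces the norm of P to have 2-adic valuation at most 2^r a, and 1 - X generates
   the only prime above 2. *)
Lemma bounded_adjoint r P a : (forall t, t \in nroots r -> 0 < `|ieval P t| <= 2 ^+ a) ->
  exists Q R M, ~~ (2 %| M)%Z /\ Q * P = (2 ^+ a * M)%:P + ('X^(2 ^ r) + 1) * R.
Proof.
move=> bndP; have normP : `|pnorm r P|%N%:R = \prod_(t <- nroots r) `|ieval P t| :> algC.
  by rewrite natr_absz intr_norm pnormE normr_prod.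
have nzP : pnorm r P != 0.
  rewrite -absz_eq0 -(eqr_nat algC) normP prodf_seq_neq0; apply/allP=> t /bndP /andP[].
  by rewrite lt0r => /andP[].
have [e [Q [R [M [oddM DnP DQ]]]]] := pnorm_extract nzP.
(* The norm is a product of 2^r values of absolute value at most 2^a, and 2^e divides it. *)
have le_e : (e <= 2 ^ r * a)%N.
  rewrite -(leq_exp2l (m := 2)) //; apply: leq_trans (_ : `|pnorm r P| <= _)%N.
    by rewrite DnP leq_pmulr // absz_gt0; apply: contraNneq oddM => ->.
  rewrite -(ler_nat algC) normP mulnC expnM natrX natrX -(size_nroots r).
  by apply: prod_norm_le => t /bndP /andP[].
have [U [Q1 [R1 [c [DU DQ1 c1]]]]] := pnorm_1X_gcd r.
(* Modulo X^(2^r) + 1 and up to the unit [Q1], (1 - X)^(2^r) is 2c, with c = 1 or -1: supplying the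
   missing factors 1 - X gives 2^a. *)
have [R2 DR2] : exists R2, ((1 - 'X) ^+ (2 ^ r) * Q1) ^+ a = ((2 * c) ^+ a)%:P + ('X^(2 ^ r) + 1) * R2.
  have D1 : (1 - 'X) ^+ (2 ^ r) * Q1 = (2 * c)%:P + ('X^(2 ^ r) + 1) * (Q1 + R1 *+ 2).
    have -> : (1 - 'X) ^+ (2 ^ r) * Q1 = ('X^(2 ^ r) + 1) * Q1 + (Q1 * U) *+ 2 by rewrite DU; ring.
    by rewrite DQ1 polyCM; ring.
  elim: a {bndP le_e} => [|a [R2 IHa]]; first by exists 0; rewrite !expr0 mulr0 addr0.
  exists ((Q1 + R1 *+ 2) * ((2 * c) ^+ a)%:P + (2 * c)%:P * R2 + ('X^(2 ^ r) + 1) * (Q1 + R1 *+ 2) * R2).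
  by rewrite !exprS IHa D1 (polyCM (2 * c)); ring.
exists (Q * (1 - 'X) ^+ (2 ^ r * a - e) * Q1 ^+ a).
exists (R2 * M%:P + R * (1 - 'X) ^+ (2 ^ r * a - e) * Q1 ^+ a), (c ^+ a * M); split.
  by rewrite dvdzE abszM abszX c1 exp1n mul1n.
have -> : Q * (1 - 'X) ^+ (2 ^ r * a - e) * Q1 ^+ a * P =
  (Q * P) * ((1 - 'X) ^+ (2 ^ r * a - e) * Q1 ^+ a) by ring.
rewrite DQ mulrDl mulrAC (mulrA ((1 - 'X) ^+ e)) -exprD subnKC // exprM -exprMn DR2.
by rewrite exprMn !polyCM; ring.
Qed.

Lemma nroots_prim r t : t \in nroots r -> (2 ^ r.+1).-primitive_root t.
Proof.
move=> /nrootsP rt; have [||m pr_t] := @prim_order_exists _ (2 ^ r.+1) t.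
- by rewrite expn_gt0.
- by rewrite expnSr exprM rt sqrrN expr1n.
case/dvdn_pfactor=> // k lek Dm; rewrite Dm in pr_t *.
move: lek; rewrite leq_eqVlt => /predU1P[<- // | ltk].
have: t ^+ (2 ^ r) = 1.
  by apply/eqP; rewrite -(prim_order_dvd pr_t) dvdn_exp2l.
by rewrite rt => /eqP; rewrite -subr_eq0 -opprD oppr_eq0 (pnatr_eq0 _ 2).
Qed.

Lemma prim_nroots r t : (2 ^ r.+1).-primitive_root t -> t \in nroots r.
Proof.
move=> pr_t; apply/nrootsP; have: t ^+ (2 ^ r) ^+ 2 = 1.
  by rewrite -exprM -expnSr prim_expr_order.
move/eqP; rewrite sqrf_eq1 => /predU1P[t1 | /eqP //].
have: (2 ^ r.+1 %| 2 ^ r)%N by rewrite (prim_order_dvd pr_t) t1.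
by rewrite dvdn_Pexp2l // ltnn.
Qed.

(** The minimal polynomial of t is cyclotomic, of degree totient(2^(r+1)) = 2^r; a nonzero remainder
    of P modulo X^(2^r) + 1 has smaller degree and cannot vanish at t. *)
Lemma ieval_nroot_eq0 r t P : t \in nroots r -> ieval P t = 0 ->
  exists R, P = ('X^(2 ^ r) + 1) * R.
Proof.
move=> rt Pt0; have pr_t := nroots_prim rt.
have sD : size ('X^(2 ^ r) + 1 : {poly int}) = (2 ^ r).+1.
  by rewrite size_polyDl size_polyXn // size_poly1 ltnS expn_gt0.
have monD : ('X^(2 ^ r) + 1 : {poly int}) \is monic.
  by rewrite -polyC1 monicXnaddC ?expn_gt0.
have := Pdiv.RingMonic.rdivp_eq monD P.
set S := Pdiv.Ring.rmodp _ _ => DP.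
have ltS : (size S <= 2 ^ r)%N by rewrite -ltnS -sD Pdiv.Ring.ltn_rmodpN0 // monic_neq0.
have St0 : ieval S t = 0.
  move: Pt0; rewrite DP ievalD ievalM ieval_Xn1 ?mulr0 ?add0r //.
  exact/nrootsP.
have [S0 | nzS] := eqVneq S 0.
  by exists (Pdiv.Ring.rdivp P ('X^(2 ^ r) + 1)); rewrite {1}DP S0 addr0 mulrC.
have [q [Dq mon_q] dv_q] := minCpolyP t.
have : root (map_poly ratr (map_poly intr S)) t.
  rewrite rootE -map_poly_comp (_ : map_poly _ S = map_poly intr S) -/(ieval S t) ?St0 //.
  by apply: eq_map_poly => c /=; rewrite ratr_int.
rewrite dv_q => /dvdp_leq; rewrite map_poly_eq0_id0 ?intr_eq0 ?lead_coef_eq0 // => /(_ nzS).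
rewrite size_map_inj_poly //; last exact: intr_inj.
rewrite -(size_map_poly (ratr : rat -> algC)) -Dq (minCpoly_cyclotomic pr_t) size_cyclotomic.
by rewrite totient_pfactor // mul1n => /leq_trans/(_ ltS); rewrite ltnn.
Qed.

Lemma pnorm_ieval r t P : t \in nroots r -> exists Q, (pnorm r P)%:~R = ieval Q t * ieval P t.
Proof.
move=> /nrootsP rt; have [Q [R DQ]] := pnorm_adjoint r P; exists Q.
by rewrite -ievalM DQ ievalD ievalM ieval_Xn1 // mul0r addr0 ievalC.
Qed.

Lemma two_1nroot r t : t \in nroots r ->
  exists U V, (1 - t) ^+ (2 ^ r) = 2 * ieval U t /\ 2 = (1 - t) ^+ (2 ^ r) * ieval V t.
Proof.
move=> /nrootsP rt; have [U [Q [R [c [DU DQ c1]]]]] := pnorm_1X_gcd r.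
have D1 : (1 - t) ^+ (2 ^ r) = 2 * ieval U t.
  rewrite -ieval1X -ieval_exp DU ievalD ieval_Xn1 // add0r mulr2n ievalD.
  by ring.
exists U, (c%:P * Q); split=> //; rewrite D1 -mulrA -ievalM.
have -> : U * (c%:P * Q) = c%:P * (Q * U) by ring.
rewrite DQ ievalM ievalD [ieval (_ * R) _]ievalM ieval_Xn1 // mul0r addr0 !ievalC -rmorphM.
have -> : c * c = 1 by case: c c1 {DQ} => [[|[|m]] | [|m]].
by rewrite mulr1.
Qed.

Lemma Aint_half_even r (c : int) a t : t \in nroots r -> a \in Aint ->
  c%:~R = (1 - t) * a -> (2 %| c)%Z.
Proof.
move=> rt Aa Dc; have [U [V [DU _]]] := two_1nroot rt.
have At : t \in Aint by apply: Aint_prim_root (nroots_prim rt).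
have := @dvdA_nat_exp 2 c%:~R (2 ^ r) isT; rewrite rpred_int => /(_ isT).
rewrite dvdC_int ?rpred_int // intrKfloor; apply.
rewrite Dc exprMn DU -eqAmod0 -mulrA eqAmodMr0 //.
by rewrite rpredM ?rpredX ?Aint_ieval.
Qed.

(** If 1 - t divides P(t) among the algebraic integers, the norm of P is even, hence so is P(1), and
    1 - t divides P(t) already in Z[t]. *)
Lemma ieval_div_1nroot r t P a j : t \in nroots r -> a \in Aint ->
  ieval P t = (1 - t) ^+ j * a -> exists P', a = ieval P' t.
Proof.
move=> rt Aa; have At : t \in Aint by apply: Aint_prim_root (nroots_prim rt).
have nz1t : 1 - t != 0.
  rewrite subr_eq0; apply: contraTneq rt => <-; apply/negP => /nrootsP.
  by rewrite expr1n => /eqP; rewrite -subr_eq0 opprK (pnatr_eq0 _ 2).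
elim: j P => [|j IHj] P DP; first by exists P; rewrite DP mul1r.
have [Q DQ] := pnorm_ieval P rt.
have even_n : (2 %| pnorm r P)%Z.
  apply: (Aint_half_even (a := ieval Q t * ((1 - t) ^+ j * a)) rt).
    by rewrite !rpredM ?rpredX ?rpredB ?Aint_ieval.
  by rewrite DQ DP exprS; ring.
have /dvdzP[c P1] : (2 %| P.[1])%Z.
  by rewrite -[P.[1]](subKr (pnorm r P)) rpredB // pnorm_parity.
have [S DS] := root_factor1 r P1; apply: (IHj S); apply: (mulfI nz1t).
rewrite mulrA -exprS -DP DS ievalD !ievalM ieval1X ieval_Xn1 ?mul0r ?addr0 //.
exact/nrootsP.
Qed.

Lemma ieval_half r t P a : t \in nroots r -> a \in Aint ->
  ieval P t = 2 * a -> exists P', a = ieval P' t.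
Proof.
move=> rt Aa DP; have [U [V [DU DV]]] := two_1nroot rt.
have At : t \in Aint by apply: Aint_prim_root (nroots_prim rt).
have [||P' DP'] := @ieval_div_1nroot r t P (ieval V t * a) (2 ^ r) rt.
- by rewrite rpredM ?Aint_ieval.
- by rewrite DP DV mulrA.
exists (U * P'); rewrite ievalM -DP' mulrA; apply: (@mulfI _ 2); first by rewrite (pnatr_eq0 _ 2).
by rewrite !mulrA -DU -DV.
Qed.

(** After clearing denominators, [ieval_half] removes the factors 2 one at a time; the odd part of
    the denominator stays as [M]. *)
Lemma Aint_Qadj_ieval r t z : t \in nroots r -> Qadj t z -> z \in Aint ->
  exists M P, odd M /\ M%:R * z = ieval P t.
Proof.
move=> rt [p ->]; have [P [D nzD ->]] := rat_poly_scale p => Az.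
have := Az; set z0 := _.[_] => {}Az.
have Dz : `|D|%N%:R * z0 = ieval ((sgz D)%:P * P) t.
  rewrite ievalM ievalC -[X in _ = X * _]mulr1 /z0 /ieval map_polyZ hornerZ -map_poly_comp.
  rewrite (@eq_map_poly _ _ _ intr) => [|b /=]; last by rewrite ratr_int.
  have -> : `|D|%N%:R = (sgz D)%:~R * D%:~R :> algC by rewrite -rmorphM -abszEsg.
  by rewrite fmorphV /= ratr_int -mulrA mulVKf ?intr_eq0 // mulr1.
have D_gt0 : (0 < `|D|)%N by rewrite absz_gt0.
clearbody z0; move: Dz D_gt0; move: (`|D|%N) (_ * P) => d P' DM d_gt0.
pose f := logn 2 d; pose M := (d`_2^')%N.
rewrite -(partnC 2%N d_gt0) p_part -/f -/M natrM -mulrA in DM.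
exists M.
have oddM : odd M by rewrite odd_2'nat part_pnat.
suffices [S DS] : exists S, M%:R * z0 = ieval S t by exists S.
have AMz : M%:R * z0 \in Aint by rewrite rpredM ?rpred_nat.
elim: f P' DM => [|f IHf] S; first by rewrite mul1r; exists S.
rewrite expnS natrM -mulrA => /esym DM.
have [|P' /IHf//] := ieval_half rt _ DM.
by rewrite rpredM ?rpred_nat.
Qed.

(** * 2-groups *)

Lemma coprime_odd_pow2 a k : odd a -> coprime a (2 ^ k).
Proof. by move=> odd_a; rewrite coprimeXr // coprimen2. Qed.

Lemma aut_pow2_exists N W a : (2 ^ N).-primitive_root W -> odd a ->
  exists nu : {rmorphism algC -> algC}, nu W = W ^+ a.
Proof.
move=> pr_W odd_a; have [nu Dnu] := Qn_aut_exists (coprime_odd_pow2 N odd_a).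
by exists nu; rewrite Dnu // (prim_expr_order pr_W).
Qed.

(** * The tower of roots of unity of 2-power order *)

Section TwoPowerRoots.

Variables (N : nat) (W : algC).
Hypothesis pr_W : (2 ^ N).-primitive_root W.

Definition wk k := W ^+ (2 ^ (N - k)).

Lemma wk_prim k : (k <= N)%N -> (2 ^ k).-primitive_root (wk k).
Proof.
move=> lekN; rewrite /wk expnB //; by apply: (dvdn_prim_root pr_W); rewrite dvdn_exp2l.
Qed.

Lemma wkN : wk N = W. Proof. by rewrite /wk subnn expr1. Qed.

Lemma wkX k l : (k <= l <= N)%N -> wk l ^+ (2 ^ (l - k)) = wk k.
Proof.
move=> /andP[lekl lelN]; rewrite /wk -exprM -expnD; congr (_ ^+ (2 ^ _)).
by rewrite addnBA // subnK.
Qed.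

Lemma aut_wk (nu : {rmorphism algC -> algC}) a k : nu W = W ^+ a -> nu (wk k) = wk k ^+ a.
Proof. by move=> nuW; rewrite /wk rmorphXn nuW -!exprM mulnC. Qed.

Lemma aut_W (nu : {rmorphism algC -> algC}) : exists2 a, nu W = W ^+ a & (0 < N)%N -> odd a.
Proof.
have [a co_a nuW] := aut_prim_rootP nu pr_W; exists a => // N0.
by rewrite -coprimen2 -(coprime_pexpr _ _ N0).
Qed.

Lemma aut_wk_fix (nu : {rmorphism algC -> algC}) a k : (k <= N)%N -> nu W = W ^+ a ->
  nu (wk k) = wk k <-> a = 1 %[mod 2 ^ k].
Proof.
move=> lekN nuW; rewrite (aut_wk _ nuW); split=> [/eqP | /eqP].
  by rewrite -{2}(expr1 (wk k)) (eq_prim_root_expr (wk_prim lekN)) => /eqP.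
by rewrite -(eq_prim_root_expr (wk_prim lekN)) expr1 => /eqP.
Qed.

Lemma wk_half k : (0 < k <= N)%N -> wk k ^+ (2 ^ k.-1) = -1.
Proof.
by case: k => // k /= lekN; apply/nrootsP/prim_nroots/wk_prim.
Qed.

Lemma aut_wk_opp (nu : {rmorphism algC -> algC}) k : (0 < k <= N)%N ->
  nu (wk k.-1) = wk k.-1 -> nu (wk k) != wk k -> nu (wk k) = - wk k.
Proof.
case: k => // k /= lekN nuk nuk1.
have : (nu (wk k.+1) == wk k.+1) || (nu (wk k.+1) == - wk k.+1).
  rewrite -eqf_sqr -rmorphXn; apply/eqP.
  by have := @wkX k k.+1; rewrite leqnSn lekN subSnn => ->.
by rewrite (negPf nuk1) => /eqP.
Qed.

Lemma wk_pow_order (e : algC) : e ^+ (2 ^ N) = 1 ->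
  exists k : 'I_N.+1, (2 ^ k).-primitive_root e.
Proof.
move=> eN; have [||d pr_e] := @prim_order_exists _ (2 ^ N) e; rewrite ?expn_gt0 //.
case/dvdn_pfactor=> // k lekN Dd.
by exists (Ordinal (lekN : k < N.+1)%N); rewrite -?Dd.
Qed.

Lemma prim_wk k (e : algC) : (k <= N)%N -> (2 ^ k).-primitive_root e ->
  exists2 j, coprime j (2 ^ k) & e = wk k ^+ j.
Proof.
move=> lekN pr_e; have [j De] := prim_rootP (wk_prim lekN) (prim_expr_order pr_e).
by exists j => //; rewrite De (prim_root_exp_coprime _ (wk_prim lekN)) in pr_e.
Qed.

Lemma aut_prim_wk (nu : {rmorphism algC -> algC}) k (e : algC) : (k <= N)%N ->
  (2 ^ k).-primitive_root e -> nu (wk k) = wk k -> nu e = e.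
Proof. by move=> lekN /(prim_wk lekN)[j _ ->] nuk; rewrite rmorphXn nuk. Qed.

Lemma aut_prim_wk_opp (nu : {rmorphism algC -> algC}) k (e : algC) : (0 < k <= N)%N ->
  (2 ^ k).-primitive_root e -> nu (wk k) = - wk k -> nu e = - e.
Proof.
case: k => // k /= lekN /(prim_wk lekN)[j co_j ->] nuk; rewrite rmorphXn nuk exprNn.
by rewrite -signr_odd -[odd j]coprimen2 -(coprime_pexpr _ _ (ltn0Sn k)) co_j mulN1r.
Qed.

Lemma wk_fix_le (nu : {rmorphism algC -> algC}) k l : (k <= l <= N)%N ->
  nu (wk l) = wk l -> nu (wk k) = wk k.
Proof. by move=> lekl nul; rewrite -(wkX lekl) rmorphXn nul. Qed.

(** Q(W) is abelian over Q, as automorphisms act on [W] by powers. *)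
Lemma aut_root_comm (nu mu : {rmorphism algC -> algC}) z : Qadj W z -> nu (mu z) = mu (nu z).
Proof.
move=> Qz; have [a nuW _] := aut_W nu; have [b muW _] := aut_W mu.
pose nm : {rmorphism algC -> algC} := nu \o mu.
pose mn : {rmorphism algC -> algC} := mu \o nu.
apply: (Qadj_eq_aut (nu := nm) (mu := mn) Qz).
by rewrite /= nuW muW !rmorphXn nuW muW -!exprM mulnC.
Qed.

End TwoPowerRoots.

(** The nontrivial 2-group A / K, with K the kernel, has a central element of order 2, which acts by
    a scalar of square 1 other than 1. *)
Lemma irr_central_involution (gT : finGroupType) (A : {group gT}) (i : Iirr A) :
  (2.-group A)%g -> i != 0 ->
  exists z, [/\ z \in A, z \notin cfker 'chi_i & 'chi_i z = - 'chi_i 1%g].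
Proof.
move=> pA nzi; pose K := cfker 'chi_i.
have pAK : (2.-group (A / K))%g by apply: quotient_pgroup.
have ntAK : (A / K != 1)%g.
  by rewrite -subG1 quotient_sub1 ?subGcfker ?normal_norm ?cfker_normal.
have ntZ : ('Z(A / K) != 1)%g by rewrite center_nil_eq1 // (pgroup_nil pAK).
have [_ dv2 _] := pgroup_pdiv (pgroupS (center_sub _) pAK) ntZ.
have [x Zx ox] := Cauchy (isT : prime 2) dv2.
have : x \in ('Z('chi_i)%CF / cfker 'chi_i)%g by rewrite cfcenter_eq_center.
move=> /morphimP[z Nz Zz /= Dx].
have Az : z \in A by apply: subsetP (cfcenter_sub 'chi_i) _ Zz.
have K'z : z \notin K.
  by apply/negP=> Kz; move: ox; rewrite Dx (coset_id Kz) order1.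
have Kz2 : (z ^+ 2)%g \in K.
  by apply: coset_idr; rewrite ?groupX // morphX //= -Dx -ox expg_order.
exists z; split=> //.
have [xi Lxi Dxi] := cfcenter_Res 'chi_i.
have xiE y : y \in 'Z('chi_i)%CF -> 'chi_i y = 'chi_i 1%g * xi y.
  by move=> Zy; rewrite -(cfResE _ (cfcenter_sub _) Zy) Dxi cfunE.
have nz1 := irr1_neq0 i.
have xi2 : xi z ^+ 2 = 1.
  rewrite -lin_charX //; apply: (mulfI nz1); rewrite -xiE ?groupX // mulr1.
  by move: Kz2; rewrite /K cfkerEirr inE => /eqP.
move: K'z; rewrite /K cfkerEirr inE xiE // -{2}['chi_i 1%g]mulr1 (inj_eq (mulfI nz1)).
move/eqP: xi2; rewrite sqrf_eq1 => /predU1P[-> | /eqP->]; first by rewrite eqxx.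
by rewrite mulrN1.
Qed.

Lemma iter_aut (g : {rmorphism algC -> algC}) j :
  exists mu : {rmorphism algC -> algC}, forall z, iter j g z = mu z.
Proof.
elim: j => [|j [mu Dmu]]; first by exists idfun.
by exists (g \o mu) => z; rewrite /= Dmu.
Qed.

Lemma iter_aut_exp (g : {rmorphism algC -> algC}) w a j :
  g w = w ^+ a -> iter j g w = w ^+ (a ^ j).
Proof. by move=> gw; elim: j => [|j IHj] //=; rewrite IHj rmorphXn gw -exprM -expnS. Qed.

(** * Integral polynomials in a field automorphism *)

Section OrbitEval.

Variables (g : {rmorphism algC -> algC}) (t : algC).

(** This is P(g) t, for the action of Z[X] in which X acts as [g]. *)
Definition orbit_eval (P : {poly int}) := \sum_(j < size P) (P`_j)%:~R * iter j g t.

Lemma orbit_eval_wide n (P : {poly int}) : (size P <= n)%N ->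
  orbit_eval P = \sum_(j < n) (P`_j)%:~R * iter j g t.
Proof.
move=> lePn; rewrite /orbit_eval (big_ord_widen _ (fun j : nat => (P`_j)%:~R * iter j g t) lePn).
rewrite big_mkcond; apply: eq_bigr => j _; case: ltnP => // lePj.
by rewrite nth_default // mul0r.
Qed.

Lemma orbit_evalD (P Q : {poly int}) : orbit_eval (P + Q) = orbit_eval P + orbit_eval Q.
Proof.
pose n := maxn (size P) (size Q).
rewrite (@orbit_eval_wide n) ?(leq_trans (size_polyD _ _)) //.
rewrite (@orbit_eval_wide n P) ?leq_maxl // (@orbit_eval_wide n Q) ?leq_maxr //.
by rewrite -big_split; apply: eq_bigr => j _; rewrite coefD rmorphD mulrDl.
Qed.

Lemma orbit_evalC_mul c P : orbit_eval (c%:P * P) = c%:~R * orbit_eval P.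
Proof.
rewrite (@orbit_eval_wide (size P)); last by rewrite mul_polyC size_scale_leq.
by rewrite mulr_sumr; apply: eq_bigr => j _; rewrite coefCM rmorphM mulrA.
Qed.

Lemma orbit_evalMX P : orbit_eval (P * 'X) = g (orbit_eval P).
Proof.
rewrite (@orbit_eval_wide (size P).+1); last first.
  by apply: leq_trans (size_polyMleq _ _) _; rewrite size_polyX addn2.
rewrite big_ord_recl coefMX mul0r add0r rmorph_sum; apply: eq_bigr => j _.
by rewrite coefMX /= rmorphM rmorph_int.
Qed.

Lemma orbit_eval1 : orbit_eval 1 = t.
Proof. by rewrite /orbit_eval size_poly1 big_ord1 coef1 mul1r. Qed.

Lemma orbit_evalXn j : orbit_eval 'X^j = iter j g t.
Proof. by elim: j => [|j IHj]; rewrite ?expr0 ?orbit_eval1 // exprSr orbit_evalMX IHj. Qed.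

Lemma orbit_evalC c : orbit_eval c%:P = c%:~R * t.
Proof. by rewrite -[c%:P]mulr1 orbit_evalC_mul orbit_eval1. Qed.

Lemma orbit_eval0 : orbit_eval 0 = 0.
Proof. by rewrite /orbit_eval size_poly0 big_ord0. Qed.

Lemma orbit_eval_sum (I : finType) (P : pred I) (F : I -> {poly int}) :
  orbit_eval (\sum_(i | P i) F i) = \sum_(i | P i) orbit_eval (F i).
Proof. by apply: (big_morph orbit_eval orbit_evalD orbit_eval0). Qed.

(** Lets computations in Z[X]/(X^d + 1) be carried over to the orbit of [t]. *)
Lemma orbit_eval_Xn1 d R : iter d g t = - t -> orbit_eval (('X^d + 1) * R) = 0.
Proof.
move=> gt; elim/poly_ind: R => [|R c IHR]; first by rewrite mulr0 orbit_eval0.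
rewrite mulrDr orbit_evalD mulrA orbit_evalMX IHR rmorph0 add0r mulrC.
by rewrite orbit_evalC_mul orbit_evalD orbit_evalXn orbit_eval1 gt addNr mulr0.
Qed.

Lemma char_ring_orbit_eval (gT : finGroupType) (A : {group gT}) P Q :
  char_ring A (2 * orbit_eval P) -> char_ring A (2 * orbit_eval (Q * P)).
Proof.
move=> RP; elim/poly_ind: Q => [|Q c IHQ].
  by rewrite mul0r orbit_eval0 mulr0; apply: char_ring0.
have -> : (Q * 'X + c%:P) * P = Q * P * 'X + c%:P * P by ring.
rewrite orbit_evalD orbit_evalMX orbit_evalC_mul mulrDr mulrCA.
apply: char_ringD; last by apply: char_ringM RP; apply: char_ring_int.
by have := char_ring_aut g IHQ; rewrite rmorphM rmorph_nat.
Qed.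

End OrbitEval.

Lemma exp5_pow2 l : exists2 v, odd v & (5 ^ (2 ^ l) = 1 + 2 ^ l.+2 * v)%N.
Proof.
elim: l => [|l [v odd_v IHl]]; first by exists 1%N.
have [|//|v' odd_v' Dv'] := @lift_exponent 2 l.+2 v isT.
  by rewrite dvdn2 odd_v.
by exists v'; [move: odd_v'; rewrite dvdn2 negbK | rewrite expnSr expnM IHl].
Qed.

(** Membership in the localization of Z[A] at 2. *)
Definition odd_in (gT : finGroupType) (A : {group gT}) z :=
  exists M, odd M /\ char_ring A (M%:R * z).

(** * Character values of a 2-group and an involution of their field *)

Section TwoGroup.

Variables (gT : finGroupType) (A : {group gT}) (N : nat) (W : algC) (m b : nat).
Variable s : {rmorphism algC -> algC}.
Hypotheses (cardA : #|A| = (2 ^ N)%N) (pr_W : (2 ^ N).-primitive_root W).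
Hypotheses (m_bnd : (2 <= m <= N)%N).
Hypothesis chars_m : forall nu : {rmorphism algC -> algC}, nu (wk N W m) = wk N W m -> fixes_chars A nu.
Hypotheses (sW : s W = W ^+ b) (b4 : (4 %| b.+1)%N).
Hypothesis bb : b * b = 1 %[mod 2 ^ m].

Local Notation wk := (wk N W).

Let pA : (2.-group A)%g. Proof. by rewrite /pgroup cardA pnatX. Qed.
Let dvA : (#|A| %| 2 ^ N)%N. Proof. by rewrite cardA. Qed.

(** By [bb], [s] induces an involution of Q(w_m), and [rho] is the trace of the character value to
    its fixed field. *)
Definition rho i x := 'chi[A]_i x + s ('chi_i x).
(** By the Galois correspondence, for k at most N, the values of [rho i] lie in Q(w_k). *)
Definition rho_fixed k i := forall nu : {rmorphism algC -> algC},
  nu (wk k) = wk k -> forall x, nu (rho i x) = rho i x.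

Lemma Qadj_irr i x : Qadj W ('chi[A]_i x).
Proof. exact: Qadj_char pr_W dvA (irr_char i). Qed.

Lemma s_invol i x : s (s ('chi[A]_i x)) = 'chi_i x.
Proof.
have /andP[_ lemN] := m_bnd; pose ss : {rmorphism algC -> algC} := s \o s.
apply: (chars_m (nu := ss)); apply/(aut_wk_fix pr_W lemN (a := (b * b)%N)) => //=.
by rewrite sW rmorphXn sW -exprM.
Qed.

Lemma rho_fixed_m i : rho_fixed m i.
Proof.
move=> nu /chars_m fix_nu x; rewrite /rho rmorphD fix_nu; congr (_ + _).
by rewrite (aut_root_comm pr_W _ _ (Qadj_irr i x)) fix_nu.
Qed.

(** The square phi of chi_i + s chi_i is a character fixed by [s], so 2 phi = phi + s phi decomposes
    into the [rho j]. An element at which chi_i takes the value -chi_i(1) lies in the kernel of phi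
    but not in that of chi_i. *)
Lemma rho_sqr i x : exists a : Iirr A -> nat,
  2 * rho i x ^+ 2 = \sum_j (a j)%:R * rho j x /\
  (i != 0 -> forall j, a j != 0%N -> (#|cfker 'chi_i| < #|cfker 'chi_j|)%N).
Proof.
pose phi := ('chi_i + cfAut s 'chi_i) ^+ 2.
have Nphi0 : 'chi_i + cfAut s 'chi_i \is a character.
  by rewrite rpredD ?cfAut_char ?irr_char.
have Nphi : phi \is a character by rewrite rpredX.
have phiE y : phi y = rho i y ^+ 2 by rewrite !cfunE.
have Da j : '[phi, 'chi_j] = (Num.truncn '[phi, 'chi_j])%:R.
  by rewrite truncnK // Cnat_cfdot_char_irr.
exists (fun j => Num.truncn '[phi, 'chi_j]); split=> [|nzi j nz_aj].
  have phi_sum y : phi y = \sum_j (Num.truncn '[phi, 'chi_j])%:R * 'chi_j y.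
    rewrite {1}[phi]cfun_sum_cfdot sum_cfunE; apply: eq_bigr => j _.
    by rewrite cfunE -Da.
  have s_phi : s (phi x) = phi x.
    by rewrite phiE rmorphXn /rho rmorphD s_invol addrC.
  rewrite -phiE mulr_natl mulr2n -{2}s_phi phi_sum rmorph_sum -big_split /=.
  by apply: eq_bigr => j _; rewrite rmorphM rmorph_nat -mulrDr.
have Cj : j \in irr_constt phi by rewrite irr_consttE Da pnatr_eq0.
have kerj := cfker_constt Nphi Cj; have [z [Az K'z Dz]] := irr_central_involution pA nzi.
have s1 : s ('chi_i 1%g) = 'chi_i 1%g by rewrite irr1_degree rmorph_nat.
apply: proper_card; rewrite properE; apply/andP; split.
  apply: subset_trans kerj; apply/subsetP=> y; rewrite cfkerEirr inE => /eqP Dy.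
  have Ay : y \in A by apply: contraTT isT => /cfun0 y0; rewrite -(irr1_neq0 i) -Dy y0 eqxx.
  by rewrite cfkerEchar // inE Ay !phiE /rho Dy /= eqxx.
apply/subsetPn; exists z => //; apply: (subsetP kerj).
by rewrite cfkerEchar // inE Az !phiE /rho Dz rmorphN s1 -opprD sqrrN /= eqxx.
Qed.

(* Take [i] with the largest kernel among the counterexamples; squaring strictly enlarges the
   kernels, and the automorphisms fixing [wk k.-1] are squares of automorphisms fixing [wk
   k.-2]. *)
Lemma rho_fixed_descent k i : (4 <= k <= m)%N -> ~ rho_fixed k.-1 i ->
  exists j, rho_fixed k.-1 j /\ ~ rho_fixed k.-2 j.
Proof.
case: k => [|[|[|[|k]]]] //= lekm; have /andP[_ lemN] := m_bnd.
have lekN : (k.+3 <= N)%N by apply: leq_trans lemN; apply: ltnW.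
have [d] := ubnP (#|A| - #|cfker 'chi_i|)%N; elim: d i => // d IHd i ltd fix'_i.
have nzi : i != 0.
  apply/eqP=> i0; case: fix'_i => nu _ x; rewrite i0 /rho irr0 cfun1E.
  by rewrite !rmorph_nat rmorphD rmorph_nat.
have ltker (j : Iirr A) : (#|cfker 'chi_i| < #|cfker 'chi[A]_j|)%N ->
    (#|A| - #|cfker 'chi[A]_j| < d)%N.
  move=> ltij; have lej : (#|cfker 'chi[A]_j| <= #|A|)%N by apply/subset_leq_card/cfker_sub.
  apply: leq_trans (_ : #|A| - #|cfker 'chi_i| <= d)%N; last by rewrite -ltnS.
  by rewrite ltn_sub2l // (leq_trans ltij lej).
have [[j [ltij fix'_j]] | all_j] :=
  classic (exists j, (#|cfker 'chi_i| < #|cfker 'chi[A]_j|)%N /\ ~ rho_fixed k.+3 j).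
  by apply: IHd fix'_j; apply: ltker.
have fix1 j : (#|cfker 'chi_i| < #|cfker 'chi[A]_j|)%N -> rho_fixed k.+3 j.
  by move=> ltij; apply: NNPP => fix'_j; apply: all_j; exists j.
apply: NNPP => no_j.
have fix2 j : (#|cfker 'chi_i| < #|cfker 'chi[A]_j|)%N -> rho_fixed k.+2 j.
  by move=> ltij; apply: NNPP => fix'_j; apply: no_j; exists j; split; first apply: fix1.
case: fix'_i => mu mu_k x.
have [l muW _] := aut_W pr_W mu.
have l1 : l = 1 %[mod 2 ^ k.+3] by apply/(aut_wk_fix pr_W lekN muW).
(* a0^2 is 1 + 2^(k+3) times an odd number and generates the residues that are 1 modulo 2^(k+3). So
   [mu] is the square on Q(W) of [nu] : W -> W^(a0^e), which fixes [wk k.+2]. *)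
pose a0 := (1 + 2 ^ k.+2)%N.
have Da0 : (a0 * a0 = 1 + 2 ^ k.+3 * (1 + 2 ^ k.+1))%N.
  by rewrite /a0 !expnS; ring.
have [||e De] := @exp_generates 2 k.+3 (1 + 2 ^ k.+1) N l isT _ _ l1.
- by rewrite dvdn_addl // expnS dvdn_mulr.
- by [].
have odd_a0 : odd a0 by rewrite oddD oddX.
have odd_ae : odd (a0 ^ e) by rewrite oddX odd_a0 orbT.
have [nu nuW] := aut_pow2_exists pr_W odd_ae.
have nu_k : nu (wk k.+2) = wk k.+2.
  apply/(aut_wk_fix pr_W (ltnW lekN) nuW).
  have a01 : a0 = 1 %[mod 2 ^ k.+2] by rewrite /a0 -modnDmr modnn addn0.
  by rewrite -modnXm a01 modnXm exp1n.
have nunu : mu (rho i x) = nu (nu (rho i x)).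
  have Qr : Qadj W (rho i x).
    apply: QadjD (Qadj_irr _ _) _; apply: (aut_Qadj_prim _ pr_W); exact: Qadj_irr.
  pose nn : {rmorphism algC -> algC} := nu \o nu.
  apply: (Qadj_eq_aut (mu := nn) Qr); rewrite /= nuW rmorphXn nuW muW -exprM.
  apply/eqP; rewrite (eq_prim_root_expr pr_W) -expnMn Da0.
  by rewrite -De.
have [a [Da lt_a]] := rho_sqr i x.
(* The [rho j] occurring have larger kernels and are fixed by [nu]; hence [nu] sends rho_i(x) to
   plus or minus itself, and its square fixes it. *)
have sqr_fix : nu (rho i x) ^+ 2 = rho i x ^+ 2.
  apply: (@mulfI _ 2); first by rewrite (pnatr_eq0 _ 2).
  rewrite Da -[2](rmorph_nat nu 2) -rmorphXn -rmorphM /= Da rmorph_sum.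
  apply: eq_bigr => j _; rewrite rmorphM rmorph_nat.
  have [-> | nz_aj] := eqVneq (a j) 0%N; first by rewrite !mul0r.
  by rewrite (fix2 _ (lt_a nzi _ nz_aj)).
rewrite nunu; move/eqP: sqr_fix; rewrite eqf_sqr => /orP[] /eqP Dr; rewrite !Dr //.
by rewrite rmorphN Dr opprK.
Qed.

(** Every [rho j] is fixed at level m; from there [rho_fixed_descent] goes down one level at a
    time. *)
Lemma rho_levels i : ~ rho_fixed m.-1 i -> forall k, (3 <= k <= m)%N ->
  exists j, rho_fixed k j /\ ~ rho_fixed k.-1 j.
Proof.
move=> fix'_i k /andP[k3 lekm]; rewrite -(subKn lekm).
have: (m - k <= m - 3)%N by rewrite leq_sub2l.
elim: (m - k)%N => [|l IHl] lel; first by rewrite subn0; exists i; split=> //; apply: rho_fixed_m.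
have [j [_ fix'_j]] := IHl (ltnW lel).
have := @rho_fixed_descent (m - l) j; rewrite -!subnS => D; apply: D; last by rewrite subnS.
rewrite leq_subr andbT; clear - lel; lia.
Qed.

Lemma s_comm (nu : {rmorphism algC -> algC}) (e : algC) : e ^+ (2 ^ N) = 1 -> nu (s e) = s (nu e).
Proof. by move=> eN; apply: (aut_root_comm pr_W); apply: Qadj_unity_root pr_W eN. Qed.

(** The powers of 5 cover the residues that are 1 modulo 4, and b is 3 modulo 4: so [e] or [s e]
    lies in the orbit of [wk k] under [g], and e + s e is symmetric in both. *)
Lemma prim_orbit k (g : {rmorphism algC -> algC}) (e : algC) :
  (3 <= k <= m)%N -> g W = W ^+ 5 -> (2 ^ k).-primitive_root e ->
  exists j, e + s e = iter j g (wk k + s (wk k)).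
Proof.
move=> /andP[k3 lekm] gW pr_e; have /andP[_ lemN] := m_bnd.
have lekN := leq_trans lekm lemN; have pr_k := wk_prim pr_W lekN.
have [c co_c De] := prim_wk pr_W lekN pr_e.
have odd_c : odd c by rewrite -coprimen2 -(@coprime_pexpr k) // (leq_trans _ k3).
have wkN1 : wk k ^+ (2 ^ N) = 1.
  by have /dvdnP[q ->] := dvdn_exp2l 2 lekN; rewrite mulnC exprM (prim_expr_order pr_k) expr1n.
have gen l : l = 1 %[mod 4] -> exists j, iter j g (wk k) = wk k ^+ l.
  move=> l1; have [j Dj] := @exp_generates 2 2 1 k l isT isT isT l1.
  exists j; have [mu Dmu] := iter_aut g j; rewrite Dmu.
  have muW : mu W = W ^+ (5 ^ j).
    by rewrite -Dmu (iter_aut_exp _ gW).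
  by rewrite (aut_wk N k muW); apply/eqP; rewrite (eq_prim_root_expr pr_k); apply/eqP.
have swk : s (wk k) = wk k ^+ b := aut_wk N k sW.
have b_k : b * b = 1 %[mod 2 ^ k].
  by rewrite -(modn_dvdm _ (dvdn_exp2l 2 lekm)) bb modn_dvdm // dvdn_exp2l.
have swk2 : s (s (wk k)) = wk k.
  rewrite swk rmorphXn swk -exprM; apply/eqP.
  by rewrite -[X in _ == X]expr1 (eq_prim_root_expr pr_k); apply/eqP.
have iter_s j z : z ^+ (2 ^ N) = 1 -> iter j g (s z) = s (iter j g z).
  by have [mu Dmu] := iter_aut g j; move=> zN; rewrite !Dmu s_comm.
have iterD j y z : iter j g (y + z) = iter j g y + iter j g z.
  by have [mu Dmu] := iter_aut g j; rewrite !Dmu rmorphD.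
have [c1 | c3] : c = 1 %[mod 4] \/ (b * c)%N = 1 %[mod 4].
- have [c1 | c3] : (c %% 4 = 1 \/ c %% 4 = 3)%N by clear - odd_c; lia.
    by left; rewrite c1.
  right; have /dvdnP[q Db] := b4.
  have {}Db : b = (4 * q.-1 + 3)%N by clear - Db; lia.
  rewrite Db (divn_eq c 4) c3; have -> : ((4 * q.-1 + 3) * (c %/ 4 * 4 + 3) =
    (4 * q.-1 * (c %/ 4) + q.-1 * 3 + 3 * (c %/ 4) + 2) * 4 + 1)%N by ring.
  by rewrite modnMDl.
- by have [j Dj] := gen c c1; exists j; rewrite iterD iter_s // Dj -De.
have [j Dj] := gen _ c3; exists j; rewrite iterD iter_s // Dj exprM -swk -rmorphXn -De addrC.
by rewrite De [s (wk k ^+ c)]rmorphXn [s (s (wk k) ^+ c)]rmorphXn swk2.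
Qed.

(* For some [x], the eigenvalues [eps] of order 2^k at [x] contribute a nonzero sum Y of terms
   [eps + s eps] to [rho i x], with 2Y in the ring. This Y is P(g) t for an integral polynomial
   P with at most 2^a terms and g : W -> W^5, and the powers of g act on [t] as those of a
   primitive 2^(k-2)-th root of 1. *)
Lemma layer_mult k i a : (3 <= k <= m)%N -> rho_fixed k i -> ~ rho_fixed k.-1 i ->
  'chi_i 1%g = (2 ^ a)%:R -> forall e, (2 ^ k).-primitive_root e ->
  odd_in A (2 ^+ a.+1 * (e + s e)).
Proof.
move=> k_bnd fix_k fix'_k Da; have /andP[k3 lekm] := k_bnd; have /andP[_ lemN] := m_bnd.
have lekN := leq_trans lekm lemN; have k_gt0 : (0 < k)%N by apply: leq_trans k3.
have [nu [nu_k [x nu_x]]] : exists nu : {rmorphism algC -> algC},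
    nu (wk k.-1) = wk k.-1 /\ exists x, nu (rho i x) <> rho i x.
  have [nu not_k] := not_all_ex_not _ _ fix'_k.
  have [nu_k not_x] := imply_to_and _ _ not_k; have [x nu_x] := not_all_ex_not _ _ not_x.
  by exists nu; split=> //; exists x.
have Ax : x \in A.
  apply: contraPT nu_x => A'x; apply; rewrite /rho (cfun0 _ A'x).
  by rewrite !(rmorph0, addr0).
have [f [eps [eps1 Df Deps]]] := char_roots (irr_char i) Ax.
have epsN r : eps r ^+ (2 ^ N) = 1.
  by have /dvdnP[q Dq] := order_dvdG Ax; rewrite -cardA Dq mulnC exprM eps1 expr1n.
have [lv Dlv] := fin_all_exists (fun r => wk_pow_order (epsN r)).
pose S L := \sum_(r | (lv r <= L)%N) (eps r + s (eps r)).
pose Y L := \sum_(r | lv r == L :> nat) (eps r + s (eps r)).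
have DS L : (0 < L)%N -> S L = S L.-1 + Y L.
  move=> L0; rewrite /S (bigID (fun r => lv r <= L.-1)%N) /=; congr (_ + _).
    by apply: eq_bigl => r; case: (L) L0 => //= L' _; apply/andb_idl/leqW.
  by apply: eq_bigl => r; case: (L) L0 => //= L' _; rewrite -ltnNge eq_sym eqn_leq andbC.
have rhoE : rho i x = S N.
  rewrite /rho -[x]expg1 Deps rmorph_sum -big_split /=.
  rewrite /S [RHS]big_mkcond; apply: eq_bigr => r _.
  by rewrite expr1 -ltnS ltn_ord.
have autS (h : {rmorphism algC -> algC}) L : (0 < L <= N)%N -> h (wk L) = - wk L ->
    h (S L) = S L.-1 - Y L.
  move=> L_bnd hL; have /andP[L0 leLN] := L_bnd.
  rewrite DS // rmorphD; congr (_ + _).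
    rewrite rmorph_sum; apply: eq_bigr => r lr.
    have lrN : (lv r <= N)%N by rewrite -ltnS.
    have h_r : h (eps r) = eps r.
      apply: (aut_prim_wk pr_W lrN (Dlv r)); apply: (wk_fix_le (l := L.-1)).
        by rewrite lr (leq_trans (leq_pred _)).
      have := @wkX N W L.-1 L; rewrite leq_pred leLN -subn1 subKn // expn1.
      by move=> /(_ isT) <-; rewrite rmorphXn hL sqrrN.
    by rewrite rmorphD s_comm // h_r.
  rewrite rmorph_sum -sumrN; apply: eq_bigr => r /eqP lr.
  have h_r : h (eps r) = - eps r by apply: (aut_prim_wk_opp pr_W L_bnd) hL; rewrite -lr.
  by rewrite rmorphD s_comm // h_r rmorphN opprD.
(* For L > k the layer [Y L] vanishes: the automorphism W -> W^(1 + 2^(L-1)) negates it, but fixes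
   w_(L-1), the lower layers and rho_i(x). *)
have rhoS d : (d <= N - k)%N -> rho i x = S (N - d)%N.
  elim: d => [|d IHd] led; first by rewrite subn0.
  have L0 : (0 < N - d <= N)%N by rewrite leq_subr subn_gt0 andbT (leq_trans led) ?leq_subr.
  have kL : (k <= (N - d).-1)%N by clear - led lekN; lia.
  have [|h hW] := @aut_pow2_exists N W (1 + 2 ^ (N - d).-1) pr_W.
    by rewrite oddD oddX orbF /= -lt0n (leq_trans k_gt0 kL).
  have hL : h (wk (N - d)) = - wk (N - d).
    by rewrite (aut_wk N _ hW) exprD expr1 (wk_half pr_W L0) mulrN1.
  have h_rho : h (rho i x) = rho i x.
    apply: fix_k; apply: (wk_fix_le (l := (N - d).-1)).
      by rewrite kL (leq_trans (leq_pred _)) ?leq_subr.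
    have := @wkX N W (N - d).-1 (N - d)%N; rewrite leq_pred leq_subr.
    have -> : (N - d - (N - d).-1 = 1)%N by clear - kL k_gt0; lia.
    by rewrite expn1 => /(_ isT) <-; rewrite rmorphXn hL sqrrN.
  have L0' : (0 < N - d)%N by case/andP: L0.
  have := autS h _ L0 hL; rewrite -(IHd (ltnW led)) h_rho (IHd (ltnW led)) DS //.
  move/addrI/eqP; rewrite -addr_eq0 -mulr2n -mulr_natl mulf_eq0 (pnatr_eq0 _ 2) /= => /eqP->.
  by rewrite addr0 subnS.
have rhok : rho i x = S k by rewrite (rhoS (N - k)%N) // subKn.
have nu_wk : nu (wk k) = - wk k.
  apply: (aut_wk_opp (N := N)) => //; first by rewrite k_gt0.
  by apply/eqP=> nuk; apply: nu_x; apply: fix_k.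
have DY : 2 * Y k = rho i x - nu (rho i x).
  rewrite rhok autS ?k_gt0 // DS //; ring.
have nzY : Y k != 0.
  by apply: contra_not_neq nu_x => Y0; apply/esym/eqP; rewrite -subr_eq0 -DY Y0 mulr0.
have RY : char_ring A (2 * Y k).
  have Rr : char_ring A (rho i x).
    by apply: char_ringD; [apply: char_ring_irr | apply/char_ring_aut/char_ring_irr].
  by rewrite DY; apply: char_ringB Rr (char_ring_aut _ Rr).
have [g gW] := aut_pow2_exists pr_W (isT : odd 5); pose t := wk k + s (wk k).
have /fin_all_exists[j Dj] r : exists j, lv r == k :> nat -> eps r + s (eps r) = iter j g t.
  have [lr | _] := eqVneq (lv r : nat) k; last by exists 0%N.
  by have := Dlv r; rewrite lr => /(prim_orbit k_bnd gW)[j Dj]; exists j.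
pose P : {poly int} := \sum_(r | lv r == k :> nat) 'X^(j r).
have DP : orbit_eval g t P = Y k.
  rewrite orbit_eval_sum; apply: eq_bigr => r lr.
  by rewrite orbit_evalXn Dj.
(* 5^(2^(k-3)) is 1 + 2^(k-1) times an odd number; therefore X^(2^(k-3)) + 1 annihilates [t]. *)
have g_t : iter (2 ^ (k - 3)) g t = - t.
  have [v odd_v Dv] := exp5_pow2 (k - 3).
  have [mu Dmu] := iter_aut g (2 ^ (k - 3)).
  have muW : mu W = W ^+ (5 ^ (2 ^ (k - 3))).
    by rewrite -Dmu (iter_aut_exp _ gW).
  have mu_k : mu (wk k) = - wk k.
    rewrite (aut_wk N k muW) Dv exprD exprM expr1.
    have -> : (k - 3).+2 = k.-1 by clear - k3; lia.
    by rewrite wk_half ?k_gt0 // -signr_odd odd_v mulrN1.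
  have wkN1 : wk k ^+ (2 ^ N) = 1.
    have /dvdnP[q ->] := dvdn_exp2l 2 lekN.
    by rewrite mulnC exprM (prim_expr_order (wk_prim pr_W lekN)) expr1n.
  by rewrite Dmu rmorphD s_comm // mu_k rmorphN opprD.
(* P is a sum of at most 2^a monomials, which gives the upper bound; a root common with X^(2^(k-3))
   + 1 would make Y = P(g) t zero. *)
have bndP z : z \in nroots (k - 3) -> 0 < `|ieval P z| <= 2 ^+ a.
  move=> rz; rewrite normr_gt0; apply/andP; split.
    apply: contraNneq nzY => /(ieval_nroot_eq0 rz)[R DR].
    by rewrite -DP DR orbit_eval_Xn1.
  have z1 : `|z| = 1 by apply/eqP; rewrite -(@pexpr_eq1 _ _ (2 ^ (k - 3))) ?expn_gt0 // -normrX (nrootsP _ _ rz) normrN1.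
  rewrite ieval_sum; apply: le_trans (ler_norm_sum _ _ _) _.
  rewrite -natrX -Da Df (eq_bigr (fun => 1)) => [|r _]; last by rewrite ievalX normrX z1 expr1n.
  by rewrite sumr_const ler_nat -[X in (_ <= X)%N]card_ord max_card.
have [Q [R [M [oddM DQ]]]] := bounded_adjoint bndP.
move=> e pr_e; have [l ->] := prim_orbit k_bnd gW pr_e.
exists `|M|%N; split.
  by move: oddM; rewrite dvdzE dvdn2 negbK.
have [mu Dmu] := iter_aut g l; rewrite Dmu.
have RP : char_ring A (2 * orbit_eval g t P) by rewrite DP.
have := char_ring_orbit_eval Q RP; rewrite DQ orbit_evalD orbit_eval_Xn1 // addr0 orbit_evalC => /(char_ring_aut mu).
have -> : `|M|%N%:R = (sgz M)%:~R * M%:~R :> algC by rewrite -rmorphM -abszEsg.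
rewrite !rmorphM rmorph_int rmorphXn /= !rmorph_nat => RQ.
have -> : (sgz M)%:~R * M%:~R * (2 ^+ a.+1 * mu t) = (sgz M)%:~R * (2 * (2 ^+ a * M%:~R * mu t)).
  by rewrite exprS; ring.
by have := char_ringM (char_ring_int A (sgz M)) RQ; rewrite rmorph_int.
Qed.

End TwoGroup.

(** * Membership up to odd factors *)

Section OddMultiples.

Variables (gT : finGroupType) (A : {group gT}).

Lemma odd_in_ring z : char_ring A z -> odd_in A z.
Proof. by exists 1%N; rewrite mul1r. Qed.

Lemma odd_inD y z : odd_in A y -> odd_in A z -> odd_in A (y + z).
Proof.
case=> M [odd_M RM] [L [odd_L RL]]; exists (M * L)%N; split; first by rewrite oddM odd_M odd_L.
have -> : (M * L)%:R * (y + z) = L%:R * (M%:R * y) + M%:R * (L%:R * z).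
  by rewrite natrM; ring.
by apply: char_ringD; apply: char_ringM => //; apply: char_ring_nat.
Qed.

Lemma odd_inM y z : odd_in A y -> odd_in A z -> odd_in A (y * z).
Proof.
case=> M [odd_M RM] [L [odd_L RL]]; exists (M * L)%N; split; first by rewrite oddM odd_M odd_L.
by rewrite natrM mulrACA; apply: char_ringM.
Qed.

Lemma odd_inB y z : odd_in A y -> odd_in A z -> odd_in A (y - z).
Proof.
move=> Oy Oz; apply: odd_inD Oy _; rewrite -mulN1r; apply: odd_inM Oz.
exact/odd_in_ring/char_ringN/char_ring1.
Qed.

Lemma odd_in_sum (I : Type) (r : seq I) (P : pred I) (F : I -> algC) :
  (forall i, P i -> odd_in A (F i)) -> odd_in A (\sum_(i <- r | P i) F i).
Proof.
move=> OF; elim/big_rec: _ => [|i x /OF]; last exact: odd_inD.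
exact/odd_in_ring/char_ring0.
Qed.

Lemma odd_in_nat M z : odd M -> odd_in A (M%:R * z) -> odd_in A z.
Proof.
move=> odd_M [L [odd_L RL]]; exists (L * M)%N; rewrite oddM odd_L odd_M natrM -mulrA.
by split.
Qed.

Lemma odd_in_int (M : int) z : ~~ (2 %| M)%Z -> odd_in A (M%:~R * z) -> odd_in A z.
Proof.
move=> oddM OM; apply: (@odd_in_nat `|M|%N); first by move: oddM; rewrite dvdzE dvdn2 negbK.
have -> : `|M|%N%:R = (sgz M)%:~R * M%:~R :> algC by rewrite -rmorphM -abszEsg.
by rewrite -mulrA; apply: odd_inM OM; apply/odd_in_ring/char_ring_int.
Qed.

Lemma irr_sum_square_le (l : seq (Iirr A)) : uniq l ->
  \sum_(i <- l) 'chi_i 1%g ^+ 2 <= #|A|%:R :> algC.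
Proof.
move=> Ul; rewrite -irr_sum_square big_uniq //= [leRHS](bigID [in l]) /= lerDl.
by apply: sumr_ge0 => i _; rewrite irr1_degree -natrX ler0n.
Qed.

(** The principal character, which is not in [l], adds 1 to the sum of squares and makes the
    inequality strict. *)
Lemma irr_deg_square_lt (l : seq (Iirr A)) a : uniq l ->
    (forall i, i \in l -> i != 0 /\ 'chi_i 1%g = (a i)%:R) ->
  (\sum_(i <- l) a i ^ 2 < #|A|)%N.
Proof.
move=> Ul Dl; have : uniq (0 :: l) by rewrite /= Ul andbT; apply/negP=> /Dl[/eqP].
move/irr_sum_square_le; rewrite big_cons irr0 cfun11 expr1n.
rewrite (eq_big_seq (fun i => (a i ^ 2)%:R)) => [|i /Dl[_ ->]]; last by rewrite natrX.
by rewrite -natr_sum -mulrS ler_nat.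
Qed.

Lemma aut_Iirr_inj (nu mu : {rmorphism algC -> algC}) (i j : Iirr A) :
  aut_Iirr nu i = aut_Iirr mu j -> forall x, nu ('chi_i x) = mu ('chi_j x).
Proof. by move=> /(congr1 (fun l => 'chi_l)); rewrite !aut_IirrE => /cfunP eq x; have := eq x; rewrite !cfunE. Qed.

Lemma aut_Iirr_deg (nu : {rmorphism algC -> algC}) (i : Iirr A) a :
  'chi_i 1%g = a%:R -> 'chi_(aut_Iirr nu i) 1%g = a%:R.
Proof. by rewrite aut_IirrE cfunE => ->; rewrite rmorph_nat. Qed.

Lemma aut_Iirr_moved_neq0 (nu : {rmorphism algC -> algC}) (i : Iirr A) x :
  nu ('chi_i x) <> 'chi_i x -> i != 0.
Proof. by move=> neq; apply: contra_not_neq neq => ->; rewrite irr0 cfun1E rmorph_nat. Qed.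

End OddMultiples.

(** * Degree bounds from Galois conjugates *)

Section Counting.

Variables (gT : finGroupType) (A : {group gT}) (N : nat) (W : algC).
Variable s : {rmorphism algC -> algC}.
Hypotheses (cardA : #|A| = (2 ^ N)%N) (pr_W : (2 ^ N).-primitive_root W).
Hypothesis s2 : forall i x, s (s ('chi[A]_i x)) = 'chi_i x.

Local Notation idaut := (aut_Iirr (idfun : {rmorphism algC -> algC})).

Let comm (nu : {rmorphism algC -> algC}) i x : nu (s ('chi[A]_i x)) = s (nu ('chi_i x)).
Proof. by apply: (aut_root_comm pr_W); apply: Qadj_char pr_W _ (irr_char i); rewrite cardA. Qed.

(** The character and its image under [nu] are distinct and nonprincipal, so 2 * 2^(2a) < 2^N. *)
Lemma moved_deg (nu : {rmorphism algC -> algC}) i x a :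
  nu ('chi[A]_i x) <> 'chi_i x -> 'chi_i 1%g = (2 ^ a)%:R -> (2 * a + 2 <= N)%N.
Proof.
move=> nu_i Di.
have := @irr_deg_square_lt _ A [:: idaut i; aut_Iirr nu i] (fun => 2 ^ a)%N.
have nzi := aut_Iirr_moved_neq0 nu_i.
rewrite cardA !big_cons big_nil addn0 addnn -mul2n -expnM -expnS ltn_exp2l //.
move=> lt_N; have {lt_N} : ((a * 2).+1 < N)%N.
  apply: lt_N => [|j].
    rewrite /= inE andbT; apply/eqP=> /aut_Iirr_inj eq_i; exact/nu_i/esym/eq_i.
  by rewrite !inE => /orP[] /eqP->; rewrite aut_Iirr_eq0; split=> //; apply: aut_Iirr_deg.
by rewrite mulnC addn2.
Qed.

(* The principal character and the images of [i] under 1, [s], [nu] and [nu s] are distinct. *)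
Lemma moved_orbit_deg (nu : {rmorphism algC -> algC}) i x y a :
  nu (rho s i x) <> rho s i x -> s ('chi[A]_i y) <> 'chi_i y ->
  'chi_i 1%g = (2 ^ a)%:R -> (2 * a + 3 <= N)%N.
Proof.
move=> nu_i s_i Di; pose nus : {rmorphism algC -> algC} := nu \o s.
have := @irr_deg_square_lt _ A [:: idaut i; aut_Iirr s i; aut_Iirr nu i; aut_Iirr nus i] (fun => 2 ^ a)%N.
have nzi := aut_Iirr_moved_neq0 s_i.
rewrite cardA !big_cons big_nil addn0.
have -> : ((2 ^ a) ^ 2 + ((2 ^ a) ^ 2 + ((2 ^ a) ^ 2 + (2 ^ a) ^ 2)) = 2 ^ (a * 2 + 2))%N.
  by rewrite expnD -expnM; ring.
rewrite ltn_exp2l // => lt_N; have {lt_N} : (a * 2 + 2 < N)%N.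
  apply: lt_N => [|j]; last first.
    by rewrite !inE => /or4P[] /eqP->; rewrite aut_Iirr_eq0; split=> //; apply: aut_Iirr_deg.
  rewrite /= !inE !negb_or !andbT -!andbA; do ?[apply/andP; split]; apply/eqP=> /aut_Iirr_inj /= eq_i.
  - exact/s_i/esym/eq_i.
  - by apply: nu_i; rewrite /rho rmorphD comm -eq_i.
  - by apply: nu_i; rewrite /rho rmorphD -eq_i addrC; congr (_ + _); apply: (fmorph_inj s); rewrite -comm -eq_i s2.
  - by apply: nu_i; rewrite /rho rmorphD comm -eq_i s2 addrC.
  - by apply: nu_i; rewrite /rho rmorphD -eq_i; congr (_ + _); apply: (fmorph_inj s); rewrite -comm -eq_i.
  - by apply: s_i; apply: (fmorph_inj nu); rewrite eq_i.
by rewrite mulnC addn2 addn3.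
Qed.

(** Four distinct nonprincipal characters: chi_i and nu chi_i, fixed by [s], and chi_j and s chi_j,
    moved by it. Then 4 * 2^(a+a') <= 2 (2^(2a) + 2^(2a')) < 2^N. *)
Lemma moved_pair_deg (nu : {rmorphism algC -> algC}) i j x y a a' :
  nu (rho s i x) <> rho s i x -> (forall z, s ('chi[A]_i z) = 'chi_i z) ->
  s ('chi[A]_j y) <> 'chi_j y ->
  'chi_i 1%g = (2 ^ a)%:R -> 'chi_j 1%g = (2 ^ a')%:R -> (a + a' + 3 <= N)%N.
Proof.
move=> nu_i s_i s_j Di Dj.
pose a2 k := (if idaut i == k then 2 ^ a else if aut_Iirr nu i == k then 2 ^ a else 2 ^ a')%N.
have := @irr_deg_square_lt _ A [:: idaut i; aut_Iirr nu i; idaut j; aut_Iirr s j] a2.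
have nzj := aut_Iirr_moved_neq0 s_j.
have nzi : i != 0.
  apply: contra_not_neq nu_i => ->; rewrite /rho irr0 cfun1E !rmorph_nat.
  by rewrite rmorphD rmorph_nat.
have Unu : idaut i != aut_Iirr nu i.
  apply/eqP=> /aut_Iirr_inj /= eq_i.
  by apply: nu_i; rewrite /rho rmorphD comm -eq_i.
have [Uij Uisj] : idaut i != idaut j /\ idaut i != aut_Iirr s j.
  split; apply/eqP=> /aut_Iirr_inj /= eq_i; apply: s_j.
    by rewrite -eq_i s_i.
  by rewrite -eq_i -s_i eq_i s2.
have [Unij Unisj] : aut_Iirr nu i != idaut j /\ aut_Iirr nu i != aut_Iirr s j.
  split; apply/eqP=> /aut_Iirr_inj /= eq_i; apply: s_j.
    by rewrite -eq_i -comm s_i.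
  by rewrite -eq_i -s_i comm eq_i s2.
have Uj : idaut j != aut_Iirr s j by apply/eqP=> /aut_Iirr_inj /= eq_j; apply/s_j/esym/eq_j.
rewrite cardA !big_cons big_nil addn0 /a2 !eqxx.
rewrite (negPf Unu) (negPf Uij) (negPf Uisj) (negPf Unij) (negPf Unisj) => lt_N.
suffices: (a + a' + 2 < N)%N by rewrite addn2 addn3.
rewrite -(@ltn_exp2l 2) //; apply: leq_ltn_trans (lt_N _ _).
- have := (nat_Cauchy (2 ^ a) (2 ^ a')%N).1; rewrite -(leq_pmul2l (isT : 0 < 2)%N).
  by congr (leq _ _); rewrite ?expnD; ring.
- by rewrite /= !inE !negb_or Unu Uij Uisj Unij Unisj Uj.
move=> k; rewrite !inE => /or4P[] /eqP->; rewrite ?eqxx;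
  rewrite ?(negPf Unu) ?(negPf Uij) ?(negPf Uisj) ?(negPf Unij) ?(negPf Unisj) ?eqxx aut_Iirr_eq0.
all: by split=> //; apply: aut_Iirr_deg.
Qed.

End Counting.

Lemma Qadj_ieval P t : Qadj t (ieval P t).
Proof.
exists (map_poly intr P); rewrite -map_poly_comp; congr _.[_].
by apply: eq_map_poly => c /=; rewrite rmorph_int.
Qed.

(** * Recovering integers from their traces *)

Section TwoGroupTrace.

Variables (gT : finGroupType) (A : {group gT}) (N : nat) (W : algC) (m b : nat).
Variable s : {rmorphism algC -> algC}.
Hypotheses (cardA : #|A| = (2 ^ N)%N) (pr_W : (2 ^ N).-primitive_root W).
Hypothesis m_bnd : (2 <= m <= N)%N.
Hypothesis chars_m : forall nu : {rmorphism algC -> algC}, nu (wk N W m) = wk N W m -> fixes_chars A nu.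
Hypotheses (sW : s W = W ^+ b) (b4 : (4 %| b.+1)%N).
Hypothesis bb : b * b = 1 %[mod 2 ^ m].
Hypothesis levels : forall k, (3 <= k <= m)%N -> exists j : Iirr A,
  rho_fixed N W s k j /\ ~ rho_fixed N W s k.-1 j.

Local Notation wk := (wk N W).

(** As b is 3 modulo 4, [s e] is the inverse of [e], and e + e^-1 is an integer for a fourth root of
    1. *)
Lemma char_ring_trace_root4 (e : algC) : e ^+ 4 = 1 -> s e = e ^+ b -> char_ring A (e + s e).
Proof.
move=> e4 ->; have [q ->] : exists q, b = (4 * q + 3)%N.
  by case/dvdnP: b4 => [[|q]] // Db; exists q; clear - Db; lia.
rewrite exprD exprM e4 expr1n mul1r.
have /eqP : (e ^+ 2) ^+ 2 = 1 by rewrite -exprM.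
rewrite sqrf_eq1 => /orP[] /eqP e2; last first.
  by rewrite exprS e2 mulrN1 subrr; apply: char_ring0.
rewrite exprS e2 mulr1; have /eqP := e2; rewrite sqrf_eq1.
case/orP=> /eqP->; apply: char_ringD; do ?apply: char_ringN; exact: char_ring1.
Qed.

Section Bound.

Variable E : nat.
Hypothesis layer : forall k (e : algC), (3 <= k <= m)%N -> (2 ^ k).-primitive_root e ->
  odd_in A (2 ^+ E * (e + s e)).

(** An odd multiple of z is an integral combination of powers of w_m; those of order at least 8 are
    covered by [layer], the others by [char_ring_trace_root4]. *)
Lemma odd_in_trace z : Qadj (wk m) z -> z \in Aint -> odd_in A (2 ^+ E * (z + s z)).
Proof.
move=> Qz Az; have /andP[m2 lemN] := m_bnd.
have rm : wk m \in nroots m.-1.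
  by apply: prim_nroots; rewrite prednK ?(leq_trans _ m2) //; apply: wk_prim lemN.
have [M [P [odd_M DP]]] := Aint_Qadj_ieval rm Qz Az.
apply: (odd_in_nat odd_M).
have -> : M%:R * (2 ^+ E * (z + s z)) = 2 ^+ E * (M%:R * z + s (M%:R * z)).
  by rewrite rmorphM rmorph_nat; ring.
rewrite DP aut_ieval /ieval !horner_coef -big_split mulr_sumr; apply: odd_in_sum => i _.
rewrite coef_map /= -mulrDr mulrCA; apply: odd_inM; first exact/odd_in_ring/char_ring_int.
rewrite -[s (wk m) ^+ i]rmorphXn.
have emN : (wk m ^+ i) ^+ (2 ^ m) = 1.
  by rewrite exprAC (prim_expr_order (wk_prim pr_W lemN)) expr1n.
have [k pr_k] : exists k : 'I_m.+1, (2 ^ k).-primitive_root (wk m ^+ i).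
  exact: wk_pow_order emN.
have [k3 | k2] := leqP 3 k; first by apply: (layer _ pr_k); rewrite k3 -ltnS ltn_ord.
apply: odd_inM; apply/odd_in_ring; first by rewrite -natrX; apply: char_ring_nat.
apply: char_ring_trace_root4; last by rewrite rmorphXn (aut_wk N m sW) exprAC.
have /dvdnP[q Dq] : (2 ^ k %| 4)%N by rewrite (dvdn_exp2l 2 (n := 2)).
by rewrite Dq mulnC exprM (prim_expr_order pr_k) expr1n.
Qed.

End Bound.

Let pA : (2.-group A)%g. Proof. by rewrite /pgroup cardA pnatX. Qed.

Lemma irr_deg_pow2 (i : Iirr A) : exists a, 'chi_i 1%g = (2 ^ a)%:R.
Proof.
have := dvd_irr1_cardG i; have [d Dd] := natrP (Cnat_irr1 i).
rewrite Dd cardA dvdC_nat => /dvdn_pfactor[] // a _ ->; by exists a.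
Qed.

Lemma layer_bound E :
    (forall (nu : {rmorphism algC -> algC}) (i : Iirr A) x a,
      nu (rho s i x) <> rho s i x -> 'chi_i 1%g = (2 ^ a)%:R -> (3 <= N)%N -> (a < E)%N) ->
  forall k (e : algC), (3 <= k <= m)%N -> (2 ^ k).-primitive_root e ->
    odd_in A (2 ^+ E * (e + s e)).
Proof.
move=> bnd k e k_bnd pr_e; have [i [fix_k fix'_k]] := levels k_bnd.
have [a Da] := irr_deg_pow2 i.
have [nu [x nu_x]] : exists nu : {rmorphism algC -> algC}, exists x, nu (rho s i x) <> rho s i x.
  apply: NNPP => all_nu; apply: fix'_k => nu _ x; apply: NNPP => nu_x.
  by apply: all_nu; exists nu, x.
have /andP[k3 lekm] := k_bnd; have /andP[_ lemN] := m_bnd.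
have ltaE := bnd nu i x a nu_x Da (leq_trans k3 (leq_trans lekm lemN)).
have := layer_mult cardA pr_W m_bnd sW b4 bb k_bnd fix_k fix'_k Da pr_e.
move/(odd_inM (odd_in_ring (char_ring_nat A (2 ^ (E - a.+1))))).
by rewrite natrX mulrA -exprD subnK.
Qed.

(** If [s] moves beta = chi_j(h), then z (beta - s beta) is a combination of the traces of z beta
    and z, and beta - s beta divides 2^(a+1) up to an odd factor. If [s] fixes all characters, 2 z
    is the trace of z. *)
Lemma two_group_odd_in z : cyclo_int_fixed W A z -> odd_in A (2 ^+ N.-1 * z).
Proof.
case=> Qz Az fix_z; have /andP[m2 lemN] := m_bnd; have N2 := leq_trans m2 lemN.
have Qwm : Qadj W (wk m) by apply/QadjX/Qadj_gen.
have descend y : Qadj W y -> (forall nu : {rmorphism algC -> algC}, fixes_chars A nu -> nu y = y) ->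
    Qadj (wk m) y.
  by move=> Qy fix_y; apply: (Qadj_galois pr_W Qwm Qy) => nu /chars_m/fix_y.
have Qzm := descend z Qz fix_z.
have s2 := s_invol pr_W m_bnd chars_m sW bb.
have [[j [h s_j]] | all_s] := classic (exists j, exists h, s ('chi[A]_j h) <> 'chi_j h).
  have [a Da] := irr_deg_pow2 j; have le_a := moved_deg cardA s_j Da.
  (* The traces may cost N - 2 - a factors 2: division by beta - s beta costs a + 1 more, for a
     total of N - 1. *)
  have layer : forall k (e : algC), (3 <= k <= m)%N -> (2 ^ k).-primitive_root e ->
      odd_in A (2 ^+ (N - 2 - a) * (e + s e)).
    apply: layer_bound => nu i x a' nu_x Da' _.
    suffices: (a' + a + 3 <= N)%N by clear; lia.
    (* If [s] moves chi_i, the bounds 2a' + 3 <= N and 2a + 2 <= N give this by parity; otherwise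
       the two pairs of conjugates are counted together. *)
    have [[y s_i] | i_fix] := classic (exists y, s ('chi_i y) <> 'chi_i y).
      by have := moved_orbit_deg cardA pr_W s2 nu_x s_i Da'; clear - le_a; lia.
    apply: (moved_pair_deg cardA pr_W s2 nu_x _ s_j Da' Da) => y.
    by apply: NNPP => s_i; apply: i_fix; exists y.
  have trace := odd_in_trace layer.
  have Ah : h \in A by apply: contraPT s_j => A'h; apply; rewrite cfun0 // rmorph0.
  have [f [eps [eps1 Df Deps]]] := char_roots (irr_char j) Ah.
  have {}Df : f = (2 ^ a)%N by apply/eqP; rewrite -(eqr_nat algC) -Df Da.
  have /fin_all_exists[nr Dnr] r : exists k, eps r = W ^+ k.
    have /dvdnP[q Dq] := order_dvdG Ah.
    have /(prim_rootP pr_W)[k Dk] : eps r ^+ (2 ^ N) = 1.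
      by rewrite -cardA Dq mulnC exprM eps1 expr1n.
    by exists k.
  pose beta := 'chi_j h; pose D : {poly int} := \sum_r ('X^(nr r) - 'X^(b * nr r)).
  have DW : ieval D W = beta - s beta.
    rewrite /beta -[h]expg1 Deps rmorph_sum -sumrB ieval_sum; apply: eq_bigr => r _.
    by rewrite ievalB !ievalX expr1 Dnr rmorphXn sW exprM.
  have nz_delta : beta - s beta != 0 by rewrite subr_eq0; apply/eqP/nesym.
  (* The values of D at these roots are conjugates of beta - s beta, hence nonzero; D is a sum of 2
     * 2^a signed monomials, hence the bound 2^(a+1). *)
  have bndD t : t \in nroots N.-1 -> 0 < `|ieval D t| <= 2 ^+ a.+1.
    move=> rt; have pr_t := nroots_prim rt; rewrite prednK ?(leq_trans _ N2) // in pr_t.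
    have [c co_c Dc] := prim_wk pr_W (leqnn N) pr_t; rewrite wkN in Dc.
    have odd_c : odd c by rewrite -coprimen2 -(@coprime_pexpr N) // (leq_trans _ N2).
    have [nu nuW] := aut_pow2_exists pr_W odd_c.
    rewrite normr_gt0 Dc -nuW -aut_ieval DW fmorph_eq0 nz_delta /=.
    rewrite -DW aut_ieval nuW -Dc ieval_sum; apply: le_trans (ler_norm_sum _ _ _) _.
    have t1 : `|t| = 1.
      by apply/eqP; rewrite -(@pexpr_eq1 _ _ (2 ^ N)) ?expn_gt0 // -normrX (prim_expr_order pr_t) normr1.
    apply: le_trans (_ : \sum_(r < f) 2 <= _).
      apply: ler_sum => r _; rewrite ievalB !ievalX; apply: le_trans (ler_normB _ _) _.
      by rewrite !normrX t1 !expr1n.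
    by rewrite sumr_const card_ord Df -[_ *+ (2 ^ a)]mulr_natr natrX exprS.
  have [Q [R [M [odd_M DQ]]]] := bounded_adjoint bndD.
  pose y := ieval Q W; have rW : W \in nroots N.-1.
    by apply: prim_nroots; rewrite prednK ?(leq_trans _ N2).
  have Dy : y * (beta - s beta) = 2 ^+ a.+1 * M%:~R.
    rewrite -DW -ievalM DQ ievalD ievalM ieval_Xn1 ?mul0r ?addr0; last exact/nrootsP.
    by rewrite ievalC rmorphM rmorphXn.
  have Abeta : beta \in Aint := Aint_irr _ _.
  have AW : W \in Aint := Aint_prim_root pr_W.
  have Ay : y \in Aint by apply: Aint_ieval.
  have Qbeta : Qadj (wk m) beta.
    apply: descend => [|nu fix_nu]; last exact: fix_nu.
    by apply: Qadj_char pr_W _ (irr_char j); rewrite cardA.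
  (* The product of y and beta - s beta is an integer, so y is fixed by whatever fixes the
     characters. *)
  have Qy : Qadj (wk m) y.
    apply: descend => [|nu fix_nu]; first by apply: Qadj_ieval.
    have nu_beta : nu beta = beta by apply: fix_nu.
    have nu_delta : nu (beta - s beta) = beta - s beta.
      by rewrite rmorphB (aut_root_comm pr_W) ?nu_beta //; apply: Qadj_trans Qwm Qbeta.
    apply: (mulIf nz_delta); rewrite -{1}nu_delta -rmorphM Dy.
    by rewrite rmorphM rmorph_int rmorphXn rmorph_nat.
  apply: (odd_in_int odd_M).
  (* Applied to y z, the identity is z (beta - s beta) = (z beta + s (z beta)) - s beta (z + s
     z). *)
  have -> : M%:~R * (2 ^+ N.-1 * z) =
      2 ^+ (N - 2 - a) * (y * z * beta + s (y * z * beta))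
        - s beta * (2 ^+ (N - 2 - a) * (y * z + s (y * z))).
    have -> : N.-1 = (N - 2 - a + a.+1)%N by clear - le_a; lia.
    rewrite exprD; transitivity (2 ^+ (N - 2 - a) * z * (2 ^+ a.+1 * M%:~R)); first by ring.
    by rewrite -Dy [s (y * z * beta)]rmorphM; ring.
  apply: odd_inB; first by apply: trace; [do 2?apply: QadjM | rewrite !rpredM].
  apply: odd_inM; first by apply/odd_in_ring/char_ring_aut/char_ring_irr.
  by apply: trace; [apply: QadjM | rewrite rpredM].
have s_fix i x : s ('chi[A]_i x) = 'chi_i x.
  by apply: NNPP => s_i; apply: all_s; exists i, x.
have -> : 2 ^+ N.-1 * z = 2 ^+ (N - 2) * (z + s z).
  have -> : N.-1 = (N - 2).+1 by clear - N2; lia.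
  by rewrite fix_z // exprS; ring.
apply: odd_in_trace Qzm Az.
apply: layer_bound => nu i x a nu_x Da N3.
have nu_i : nu ('chi_i x) <> 'chi_i x.
  by move=> nu_i; apply: nu_x; rewrite /rho s_fix rmorphD nu_i.
have := moved_deg cardA nu_i Da; clear - N3; lia.
Qed.

End TwoGroupTrace.

(** * Choice of the level and of the involution, and conclusion for 2-groups *)

Lemma cyclo_int_fixed_dvd n m w W (gT : finGroupType) (G : {group gT}) z :
    n.-primitive_root w -> m.-primitive_root W -> (#|G| %| m)%N -> (m %| n)%N ->
  cyclo_int_fixed w G z -> cyclo_int_fixed W G z.
Proof.
move=> pr_w pr_W dv_m dv_n [Qz Az fix_z]; split=> //.
have QW : Qadj w W.
  by apply: (Qadj_unity_root pr_w); have /dvdnP[q ->] := dv_n; rewrite mulnC exprM (prim_expr_order pr_W) expr1n.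
apply: (Qadj_galois pr_w QW Qz) => nu nuW; apply: fix_z => i x.
by apply: Qadj_fix nuW; apply: Qadj_char pr_W dv_m (irr_char i).
Qed.

Lemma sqr_opp1_mod b m : (2 <= m)%N -> (2 ^ m.-1 %| b.+1)%N -> b * b = 1 %[mod 2 ^ m].
Proof.
case: m => [|[|m]] //= _ dv_b.
have b2 : (2 %| b.+1)%N by apply: dvdn_trans dv_b; rewrite expnS dvdn_mulr.
case: b b2 dv_b => // b b2 dv_b.
have -> : (b.+1 * b.+1 = b.+2 * b + 1)%N by ring.
have /eqP dv0 : (2 ^ m.+2 %| b.+2 * b)%N.
  by rewrite expnSr dvdn_mul //; move: b2; rewrite !dvdn2 /= negbK.
by rewrite -modnDml dv0.
Qed.

Lemma classical_first (P : nat -> Prop) a d : P (a + d)%N ->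
  exists k, [/\ (a <= k <= a + d)%N, P k & (a < k)%N -> ~ P k.-1].
Proof.
elim: d => [|d IHd] Pd; first by exists a; rewrite addn0 ltnn leqnn in Pd *.
have [/IHd[k [/andP[k1 k2] Pk k'P]] | notPd] := classic (P (a + d)%N).
  by exists k; split=> //; rewrite k1 (leq_trans k2) // leq_add2l.
by exists (a + d.+1)%N; rewrite leqnn leq_addr addnS; split; rewrite // -addnS.
Qed.

Section ChooseInvolution.

Variables (gT : finGroupType) (A : {group gT}) (N m : nat) (W : algC).
Hypotheses (cardA : #|A| = (2 ^ N)%N) (pr_W : (2 ^ N).-primitive_root W) (m_bnd : (2 <= m <= N)%N).
Hypothesis chars_m : forall nu : {rmorphism algC -> algC}, nu (wk N W m) = wk N W m -> fixes_chars A nu.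

(* If both [W -> W^-1] and [W -> - W^-1] (at level m) failed, then [nu] would fix [chi_i x]. *)
Lemma choose_involution (nu : {rmorphism algC -> algC}) i x : (3 <= m)%N ->
    nu (wk N W m.-1) = wk N W m.-1 -> nu ('chi[A]_i x) <> 'chi_i x ->
  exists b (s : {rmorphism algC -> algC}),
    [/\ s W = W ^+ b, (4 %| b.+1)%N, (2 ^ m.-1 %| b.+1)%N & ~ rho_fixed N W s m.-1 i].
Proof.
move=> m3 nu_m nu_i; have /andP[m2 lemN] := m_bnd; have m0 : (0 < m)%N := ltnW m2.
have N0 : (0 < 2 ^ N)%N by rewrite expn_gt0.
(* W -> W^b1 is inversion; as w_m^(2^(m-1)) = -1, W -> W^b2 sends w_m to - w_m^-1. *)
pose b1 := (2 ^ N).-1; pose b2 := (2 ^ N + 2 ^ m.-1).-1.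
have Db1 : b1.+1 = (2 ^ N)%N by rewrite prednK.
have Db2 : b2.+1 = (2 ^ N + 2 ^ m.-1)%N by rewrite prednK // addn_gt0 N0.
have dv4 k : (2 <= k)%N -> (4 %| 2 ^ k)%N by move=> k2; apply: (dvdn_exp2l 2 k2).
have m1 : (2 <= m.-1)%N by rewrite -ltnS prednK.
have dv_b1 : (2 ^ m.-1 %| b1.+1)%N by rewrite Db1 dvdn_exp2l // (leq_trans (leq_pred _)).
have dv_b2 : (2 ^ m.-1 %| b2.+1)%N by rewrite Db2 dvdn_add // -Db1.
have dv4_1 : (4 %| b1.+1)%N by rewrite Db1 dv4 // (leq_trans m2).
have dv4_2 : (4 %| b2.+1)%N by rewrite Db2 dvdn_add ?dv4 // (leq_trans m2).
have odd_b b : (4 %| b.+1)%N -> odd b.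
  by move=> /(dvdn_trans (isT : 2 %| 4)%N); rewrite dvdn2 /= negbK.
have [s1 s1W] := aut_pow2_exists pr_W (odd_b _ dv4_1).
have [s2 s2W] := aut_pow2_exists pr_W (odd_b _ dv4_2).
apply: NNPP => no_s.
have fix1 : rho_fixed N W s1 m.-1 i by apply: NNPP => fix'_i; apply: no_s; exists b1, s1.
have fix2 : rho_fixed N W s2 m.-1 i by apply: NNPP => fix'_i; apply: no_s; exists b2, s2.
have nu_wm : nu (wk N W m) = - wk N W m.
  apply: aut_wk_opp => //; first by rewrite m0.
  by apply/eqP=> /chars_m/(_ i x).
have QW : Qadj W ('chi_i x) by apply: Qadj_char pr_W _ (irr_char i); rewrite cardA.
have Qwm : Qadj (wk N W m) ('chi_i x).
  by apply: (Qadj_galois pr_W _ QW) => [|mu /chars_m //]; apply/QadjX/Qadj_gen.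
have s2E : s2 ('chi_i x) = s1 (nu ('chi_i x)).
  pose s1nu : {rmorphism algC -> algC} := s1 \o nu.
  apply: (Qadj_eq_aut (mu := s1nu) Qwm); rewrite /= nu_wm rmorphN.
  rewrite (aut_wk N m s1W) (aut_wk N m s2W).
  have -> : b2 = (b1 + 2 ^ m.-1)%N by apply: succn_inj; rewrite Db2 -addSn Db1.
  by rewrite exprD wk_half ?m0 // mulrN1.
have nu2 : nu (nu ('chi_i x)) = 'chi_i x.
  pose nunu : {rmorphism algC -> algC} := nu \o nu.
  by apply: (chars_m (nu := nunu)); rewrite /= nu_wm rmorphN nu_wm opprK.
(* With c = chi_i(x), these say nu c + s1 nu c = c + s1 c and nu c + s1 c = c + s1 nu c; adding them
   gives 2 nu c = 2 c. *)
have := fix2 nu nu_m x; have := fix1 nu nu_m x.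
rewrite /rho s2E !rmorphD !(aut_root_comm pr_W nu) //; last first.
  by apply: (aut_Qadj_prim _ pr_W).
rewrite nu2 => E1 E2; apply: nu_i; apply: (@mulfI _ 2); first by rewrite (pnatr_eq0 _ 2).
set c := 'chi_i x in E1 E2 *; apply: (addIr (s1 (nu c) + s1 c)).
transitivity (nu c + s1 (nu c) + (nu c + s1 c)); first by ring.
by rewrite E1 E2; ring.
Qed.

End ChooseInvolution.

Lemma two_group_char_ring n w (gT : finGroupType) (A : {group gT}) z :
    n.-primitive_root w -> (#|A| %| n)%N -> (2.-group A)%g -> A :!=: 1%g ->
  cyclo_int_fixed w A z -> char_ring A ((#|A| %/ 2)%:R * z).
Proof.
move=> pr_w dv_n pA ntA cz; have [N cardA] := p_natP pA.
have N0 : (0 < N)%N.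
  by rewrite lt0n; apply: contraNneq ntA => N0; rewrite trivg_card1 cardA N0.
have -> : (#|A| %/ 2)%N = (2 ^ N.-1)%N by rewrite cardA -{1}(prednK N0) expnS mulKn.
pose W := w ^+ (n %/ 2 ^ N); have dvA : (#|A| %| 2 ^ N)%N by rewrite cardA.
have pr_W : (2 ^ N).-primitive_root W.
  by rewrite /W; apply: (dvdn_prim_root pr_w); rewrite -cardA.
have {cz}cz : cyclo_int_fixed W A z.
  by apply: (cyclo_int_fixed_dvd pr_w pr_W dvA _ cz); rewrite -cardA.
have fixW (nu : {rmorphism algC -> algC}) : nu W = W -> fixes_chars A nu.
  by move=> nuW i x; apply: Qadj_fix nuW; apply: Qadj_char pr_W dvA (irr_char i).
have [k Rk] := char_ring_exp_card pr_W dvA cz.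
(* By [char_ring_exp_card] some power of 2 times z is in Z[A], so an odd factor M can be removed by
   a Bezout relation. *)
suffices [M [odd_M RM]] : odd_in A (2 ^+ N.-1 * z).
  have [u Du] : exists u, (u.1 * M - u.2 * #|A| ^ k)%N = 1%N.
    apply/coprimeP; first by case: (M) odd_M.
    by rewrite cardA -expnM coprime_odd_pow2.
  have {}Du : (u.1 * M)%N%:R = (u.2 * #|A| ^ k)%N%:R + 1 :> algC.
    rewrite -(natrD _ _ 1); congr _%:R; clear - Du; lia.
  have -> : (2 ^ N.-1)%:R * z =
      u.1%:R * (M%:R * (2 ^+ N.-1 * z)) - u.2%:R * 2 ^+ N.-1 * (#|A|%:R ^+ k * z).
    transitivity (((u.1 * M)%N%:R - (u.2 * #|A| ^ k)%N%:R) * ((2 ^ N.-1)%:R * z)).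
      by rewrite Du addrAC subrr add0r mul1r.
    by rewrite !natrM !natrX; ring.
  apply: char_ringB; apply: char_ringM => //; first exact: char_ring_nat.
  by rewrite -natrX -natrM; apply: char_ring_nat.
have [N2 | N1] := leqP 2 N; last first.
  have {N0 N1}N1 : N = 1%N by apply/eqP; rewrite eqn_leq N0 andbT -ltnS.
  have [QW Az fix_z] := cz.
  rewrite N1 mul1r; apply: odd_in_ring; apply: char_ring_Cint.
  apply: (Qadj_aut_int pr_W QW Az) => nu; apply: fix_z; apply: fixW.
  have -> : W = -1 by have := wk_half pr_W (k := N); rewrite N1 wkN; apply.
  exact: rmorphN1.
pose chars m := forall nu : {rmorphism algC -> algC}, nu (wk N W m) = wk N W m -> fixes_chars A nu.
have [|m [m_bnd chars_m m_min]] := @classical_first chars 2 (N - 2).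
  by rewrite subnKC // /chars wkN.
rewrite subnKC // in m_bnd; have /andP[m2 lemN] := m_bnd.
(* For m = 2 no level k >= 3 occurs, and an [s] inverting [W] will do. *)
have [m3 | lem2] := ltnP 2 m; last first.
  have Dm : m = 2 by apply/eqP; rewrite eqn_leq lem2.
  have N0' : (0 < 2 ^ N)%N by rewrite expn_gt0.
  have dv4 : (4 %| (2 ^ N).-1.+1)%N by rewrite prednK // (dvdn_exp2l 2 N2).
  have odd_b : odd (2 ^ N).-1.
    by have := dvdn_trans (isT : 2 %| 4)%N dv4; rewrite dvdn2 /= negbK.
  have [s sW] := aut_pow2_exists pr_W odd_b.
  apply: (two_group_odd_in cardA pr_W m_bnd chars_m sW dv4 _ _ cz) => [|j].
    by apply: sqr_opp1_mod => //; apply: dvdn_trans dv4; rewrite Dm.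
  by rewrite Dm => /andP[/leq_trans j3 /j3].
(* m cannot be lowered by one, so some automorphism fixing w_(m-1) moves a character value. *)
have [nu [nu_m [i [x nu_i]]]] : exists nu : {rmorphism algC -> algC},
    nu (wk N W m.-1) = wk N W m.-1 /\ exists (i : Iirr A) x, nu ('chi_i x) <> 'chi_i x.
  have [nu not_m] := not_all_ex_not _ _ (m_min m3); exists nu.
  have [nu_m not_fix] := imply_to_and _ _ not_m; split=> //.
  by have [i not_i] := not_all_ex_not _ _ not_fix; exists i; apply: not_all_ex_not.
have [b [s [sW b4 bm not_fix]]] := choose_involution cardA pr_W m_bnd chars_m m3 nu_m nu_i.
have bb := sqr_opp1_mod m2 bm.
apply: (two_group_odd_in cardA pr_W m_bnd chars_m sW b4 bb _ cz).
exact: (rho_levels cardA pr_W m_bnd chars_m sW bb not_fix).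
Qed.

(** * Nilpotent groups *)

(** Unless G is a 2-group, write G = P x Q for an odd prime p. If Q = 1, the factor p is gained in
    P. Otherwise a prime q is gained in Q by induction, and the traces at x in P cost only |C_P(x)|,
    a divisor of |P|. *)
Lemma nilpotent_char_ring n w (gT : finGroupType) (G : {group gT}) :
    n.-primitive_root w -> (#|G| %| n)%N -> nilpotent G -> G :!=: 1%g ->
  exists p, [/\ prime p, (p %| #|G|)%N &
    forall z, cyclo_int_fixed w G z -> char_ring G ((#|G| %/ p)%:R * z)].
Proof.
move=> pr_w; have [d] := ubnP #|G|; elim: d => // d IHd in G * => ltGd dv_n nilG ntG.
have [p2 | not2] := boolP (2.-group G)%g.
  have [_ dv2 _] := pgroup_pdiv p2 ntG; exists 2; split=> // z.
  exact: two_group_char_ring pr_w dv_n p2 ntG.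
have [p [pr_p dv_p odd_p]] : exists p, [/\ prime p, (p %| #|G|)%N & odd p].
  apply: NNPP => no_p; case/negP: not2; apply/(pnatP _ (cardG_gt0 G)) => p pr_p dv_p.
  by have [/eqP // | odd_p] := even_prime pr_p; case: no_p; exists p.
have pP : (p.-group 'O_p(G))%g := pcore_pgroup p G.
have PxQ := nilpotent_pcoreC p nilG; set P := 'O_p(G)%G in pP PxQ.
set Q := 'O_p^'(G)%G in PxQ.
have cardG : (#|P| * #|Q|)%N = #|G| := dprod_card PxQ.
have dv_P : (#|P| %| n)%N by rewrite (dvdn_trans _ dv_n) // -cardG dvdn_mulr.
have dv_Q : (#|Q| %| n)%N by rewrite (dvdn_trans _ dv_n) // -cardG dvdn_mull.
have p'Q : ~~ (p %| #|Q|)%N by rewrite -p'natE //; apply: pcore_pgroup.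
have ntP : P :!=: 1%g.
  apply: contraNneq p'Q => P1; have cardP : #|P| = 1%N by rewrite P1 cards1.
  by move: dv_p; rewrite -cardG cardP mul1n.
have [x Px [ntx full_x]] := odd_pgroup_full_elt pr_w dv_P pr_p odd_p pP.
have [Q1 | ntQ] := eqVneq (Q : {set gT}) 1%g.
  have GP : G = P by apply/val_inj; move: PxQ; rewrite /= Q1 dprodg1.
  exists p; split=> // z; rewrite GP => -[Qz Az fix_z].
  by apply: (pgroup_char_gain pr_w dv_P pr_p odd_p pP Px (ntx ntP) Qz Az) => nu /full_x/fix_z.
have ltQG : (#|Q| < #|G|)%N by rewrite -cardG ltn_Pmull ?cardG_gt0 // cardG_gt1.
have [|q [pr_q dv_q kill_q]] := IHd Q (leq_trans ltQG ltGd) dv_Q _ ntQ.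
  exact: nilpotentS (pcore_sub _ _) nilG.
have dv_qG : (q %| #|G|)%N by rewrite -cardG dvdn_mull.
exists q; split=> // z cz.
have [k Dk] : exists k, (#|G| %/ q = k * (#|('C_P[x])%g| * (#|Q| %/ q)))%N.
  have /dvdnP[k Dk] : (#|('C_P[x])%g| %| #|P|)%N by apply: cardSg; apply: subsetIl.
  by exists k; rewrite mulnA -Dk muln_divA // cardG.
rewrite Dk natrM -mulrA; apply: char_ringM; first exact: char_ring_nat.
exact: (char_ring_dprod_step PxQ pr_w dv_n Px full_x kill_q).
Qed.

(** Passes from the generated field Q(G) to the Galois-theoretic condition; Q(w) is closed under
    inverses as the image of a number field. *)
Lemma char_field_cyclo_int_fixed n w (gT : finGroupType) (G : {group gT}) z :
    n.-primitive_root w -> (#|G| %| n)%N ->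
  ring_of_integers (char_field G) z -> cyclo_int_fixed w G z.
Proof.
move=> pr_w dv_n [Kz Az]; have [L _ [io [_ _ QE]]] := cyclotomic_num_field pr_w.
have QV y : Qadj w y -> Qadj w y^-1.
  by move=> /QE[a ->]; apply/QE; exists a^-1; rewrite fmorphV.
split=> // [|nu fix_nu]; move: {Az}z Kz; apply: subfield_gen_ind => //.
- by move=> _ [i [g [_ ->]]]; apply: Qadj_char pr_w dv_n (irr_char i).
- exact: Qadj1.
- by move=> x y _ Qx _; apply: QadjB.
- by move=> x y _ Qx _; apply: QadjM.
- by move=> x _; apply: QV.
- by move=> _ [i [g [_ ->]]]; apply: fix_nu.
- exact: rmorph1.
- by move=> x y _ nux _ nuy; rewrite rmorphB nux nuy.
- by move=> x y _ nux _ nuy; rewrite rmorphM nux nuy.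
by move=> x _ nux; rewrite fmorphV nux.
Qed.

Lemma quotient_exponent_dvd (V : zmodType) (A B : V -> Prop) d :
    (forall x y, B x -> B y -> B (x - y)) -> (0 < d)%N -> kills_quotient A B d ->
  exists2 e, is_quotient_exponent A B e & (e %| d)%N.
Proof.
move=> BB d0 kill_d; have Bmuln x k : B x -> B (x *+ k).
  move=> Bx; have B0 : B 0 by rewrite -(subrr x); apply: BB.
  elim: k => // k IHk; rewrite mulrSr -[x in _ + x]opprK; apply: (BB _ _ IHk).
  by rewrite -sub0r; apply: BB.
have [e [e0 kill_e min_e]] : exists e, is_quotient_exponent A B e.
  move: d d0 kill_d; apply: ltn_ind => d IHd d0 kill_d.
  have [[k [ltkd k0 kill_k]] | min_d] :=
    classic (exists k, [/\ (k < d)%N, (0 < k)%N & kills_quotient A B k]).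
    exact: IHd kill_k.
  exists d; split=> // k k0 kill_k; rewrite leqNgt; apply/negP=> ltkd.
  by apply: min_d; exists k.
exists e => //; rewrite /dvdn; apply: contraT; rewrite -lt0n => r0.
have := ltn_pmod d e0; rewrite ltnNge => /negP[]; apply: min_e => // x Ax.
have -> : x *+ (d %% e) = x *+ d - x *+ e *+ (d %/ e).
  by rewrite {2}(divn_eq d e) mulrnDr mulnC mulrnA addrAC subrr add0r.
by apply: BB; [apply: kill_d | apply/Bmuln/kill_e].
Qed.

Theorem theoremB (gT : finGroupType) (G : {group gT})
    (ntG : G :!=: 1%g) (nilG : nilpotent G) :
  (exists e : nat,
     [/\ is_quotient_exponent (ring_of_integers (char_field G)) (char_ring G) e,
         (e %| #|G|)%N
       & e <> #|G|])
  /\ (forall z : algC,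
        ring_of_integers (char_field G) z -> char_ring G (#|G|%:R * z)).
Proof.
have [w pr_w] := C_prim_root_exists (cardG_gt0 G).
have [p [pr_p dv_p kill_p]] := nilpotent_char_ring pr_w (dvdnn _) nilG ntG.
have p_gt1 := prime_gt1 pr_p; have d0 : (0 < #|G| %/ p)%N by rewrite divn_gt0 ?prime_gt0 // dvdn_leq.
have kill z : ring_of_integers (char_field G) z -> char_ring G ((#|G| %/ p)%:R * z).
  by move/(char_field_cyclo_int_fixed pr_w (dvdnn _)); apply: kill_p.
split=> [|z /kill Rz]; last first.
  rewrite -{1}(divnK dv_p) mulnC natrM -mulrA.
  by apply: char_ringM Rz; apply: char_ring_nat.
have [|e exp_e dv_e] := quotient_exponent_dvd (@char_ringB _ G) d0 (A := ring_of_integers (char_field G)).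
  by move=> z /kill; rewrite mulr_natl.
exists e; split=> //; first by rewrite (dvdn_trans dv_e) // -{2}(divnK dv_p) dvdn_mulr.
move=> De; have := dvdn_leq d0 dv_e.
by rewrite De leqNgt ltn_Pdiv.
Qed.
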